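(* Let $n\ge 2$ and $0<p<2$. Then $$c(n,p)=2^{p-1},$$ and the minimum of $J_p$ over $\mathcal{P}_0(\mathbb{S}^{n-1})$ is attained only by measures of the form $\mu=\frac12(\delta_v+\delta_{-v})$ for some $v\in\mathbb{S}^{n-1}$. Moreover, $$C(n,p)=J_p(\sigma_{n-1}).$$
   Context: $\mathcal{P}_0(\mathbb{S}^{n-1})$ is the set of Borel probability measures $\mu$ on the unit sphere $\mathbb{S}^{n-1}\subset\mathbb{R}^n$ with barycenter $\int v\,d\mu(v)=0$. For such $\mu$, $J_p(\mu)=\iint_{\mathbb{S}^{n-1}\times\mathbb{S}^{n-1}}|v-w|^p\,d\mu(v)\,d\mu(w)$, and $c(n,p)=\inf_{\mu\in\mathcal{P}_0(\mathbb{S}^{n-1})}J_p(\mu)$, $C(n,p)=\sup_{\mu\in\mathcal{P}_0(\mathbb{S}^{n-1})}J_p(\mu)$ (both attained). $\sigma_{n-1}=\mathcal{H}^{n-1}(\mathbb{S}^{n-1})^{-1}\mathcal{H}^{n-1}\lfloor_{\mathbb{S}^{n-1}}$ is the uniform probability measure on the sphere, and $\delta_v$ is the Dirac mass at $v$. *)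

(* Defs.v *)
From HB Require Import structures.
From mathcomp Require Import all_boot all_order all_algebra.
From mathcomp Require Import all_classical all_reals all_analysis.
Set Implicit Arguments.
Unset Strict Implicit.
Unset Printing Implicit Defensive.
Import Order.TTheory GRing.Theory Num.Theory numFieldNormedType.Exports.
Local Open Scope classical_set_scope.
Local Open Scope ring_scope.

(* The canonical norm of 'rV[R]_n is the sup norm, hence this definition. It
   induces the same topology, so the Borel sets can be taken from the library
   topology. *)
Definition enorm (R : realType) (n : nat) (x : 'rV[R]_n) : R :=
  Num.sqrt (\sum_(i < n) x ord0 i ^+ 2).

Notation borelRn R n := (g_sigma_algebraType (@open 'rV[R]_n)).

Definition sphere (R : realType) (n : nat) : set 'rV[R]_n :=
  [set x | enorm x = 1].
Arguments sphere : clear implicits.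

Section hausdorff_measure.
Context (R : realType) (n : nat).
Implicit Types A F : set 'rV[R]_n.
Local Open Scope ereal_scope.

Definition ediam A : \bar R :=
  ereal_sup [set (enorm (x - y))%:E | x in A & y in A].

(* Without the usual normalizing factor (depending on k only): only the
   normalization of the measure to total mass 1 is used below. *)
Definition hausdorff_gauge (k : nat) A : \bar R :=
  if A == set0 then 0 else ediam A ^+ k.

Definition hausdorff_pre (k : nat) (e : R) A : \bar R :=
  ereal_inf [set \sum_(i <oo) hausdorff_gauge k (F i) | F in
    [set F : (set 'rV[R]_n)^nat |
      (forall i, ediam (F i) <= e%:E) /\ A `<=` \bigcup_i F i]].

Definition hausdorff (k : nat) A : \bar R :=
  ereal_sup [set hausdorff_pre k e A | e in [set e : R | (0 < e)%R]].

End hausdorff_measure.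

Section enorm_theory.
Context (R : realType) (n : nat).
Implicit Types x y : 'rV[R]_n.

Lemma enorm_ge0 x : 0 <= enorm x. Proof. exact: sqrtr_ge0. Qed.

Lemma enorm0 : enorm (0 : 'rV[R]_n) = 0.
Proof. by rewrite /enorm big1 ?sqrtr0// => i _; rewrite mxE expr0n. Qed.

Lemma ler_norm_enorm x : `|x| <= enorm x.
Proof.
rewrite [`|x|]mx_normrE; apply: bigmax_le => [|[i j] _]; first exact: enorm_ge0.
rewrite /= (ord1 i) -sqrtr_sqr ler_wsqrtr// (bigD1 j)//= lerDl.
by apply: sumr_ge0 => k _; exact: sqr_ge0.
Qed.

Lemma continuous_enorm : continuous (@enorm R n).
Proof.
have cS s : continuous (fun y : 'rV[R]_n => \sum_(i <- s) y ord0 i ^+ 2).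
  elim: s => [|i s ih].
    by under eq_fun do rewrite big_nil; exact: cst_continuous.
  under eq_fun do rewrite big_cons; move=> x; have ci := @coord_continuous R 1 n ord0 i x.
  apply: (cvgD (F := nbhs x)) (ih x).
  exact: (cvgM (F := nbhs x) ci ci).
by move=> x; apply: continuous_comp; [exact: cS|exact: sqrt_continuous].
Qed.

Lemma measurable_sphere : measurable (sphere R n : set (borelRn R n)).
Proof.
have csph : closed (sphere R n).
  have -> : sphere R n = @enorm R n @^-1` [set 1] by [].
  by apply: preimage_closed; [move=> ? _; exact: continuous_enorm|exact: closed_eq].
rewrite -[X in measurable X]setCK; apply: measurableC.
by apply: sub_sigma_algebra; exact: closed_openC.
Qed.

End enorm_theory.

(* Caratheodory's criterion: an outer measure that is additive on separated
   sets measures the open sets. *)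
Section metric_outer_measure.
Context (R : realType) (V : normedModType R).
Variable mu : {outer_measure set V -> \bar R}.
Local Open Scope ereal_scope.

Hypothesis mu_sep : forall (A B : set V) (e : R), (0 < e)%R ->
  (forall x y, A x -> B y -> (e <= `|x - y|)%R) -> mu A + mu B <= mu (A `|` B).

Lemma open_caratheodory (U : set V) : open U -> mu.-caratheodory U.
Proof.
move=> oU; apply: le_caratheodory_measurable => X.
have [->|] := eqVneq (mu X) +oo; first by rewrite leey.
rewrite -ltey => muX.
pose r (k : nat) : R := k.+1%:R^-1%R.
have r0 k : (0 < r k)%R by rewrite /r invr_gt0.
pose W k := [set x : V | forall z, ~ U z -> (r k <= `|x - z|)%R].
pose D k := W k.+1 `\` W k.
have rS k : (r k.+1 < r k)%R by rewrite /r ltf_pV2 ?posrE// ltr_nat.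
have WU k : W k `<=` U.
  move=> x Wx; apply: contrapT => /Wx.
  by rewrite subrr normr0 leNgt r0.
have WS k : W k `<=` W k.+1 by move=> x Wx z /Wx; apply: le_trans; exact/ltW.
have sepW k : forall x y, W k x -> ~ W k.+1 y -> (r k - r k.+1 <= `|x - y|)%R.
  move=> x y Wx /existsNP[z /not_implyP[Uz /negP]]; rewrite -ltNge => yz.
  rewrite lerBlDr (le_trans (Wx _ Uz))//.
  rewrite (le_trans (ler_distD y x z))// lerD2l; exact/ltW.
have UW : U = \bigcup_k W k.
  apply/seteqP; split => [x Ux|x [k _ /WU//]].
  have /nbhs_ballP[e/= e0 eU] : nbhs x U by exact: open_nbhs_nbhs.
  have [k ke] : exists k, (r k < e)%R.
    by have [k _ /(_ k (leqnn k))] := near_infty_natSinv_lt (PosNum e0); exists k.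
  exists k => // z Uz; rewrite leNgt; apply/negP => xz; apply: Uz; apply: eU.
  by rewrite -ball_normE/=; exact: lt_trans ke.
have sumD k : \sum_(0 <= i < k.+1) mu (X `&` D i) <=
    mu (X `&` W k.+1) + mu (X `&` W k).
  elim: k => [|k ih].
    rewrite big_nat1; apply: (@le_trans _ _ (mu (X `&` W 1%N))).
      by apply: le_outer_measure => x [Xx []].
    by rewrite leeDl// outer_measure_ge0.
  rewrite big_nat_recr//= (le_trans (leeD2r _ ih))//.
  rewrite -addeA addeC leeD2r//.
  apply: le_trans (mu_sep (e := r k - r k.+1) _ _) _.
  - by rewrite subr_gt0.
  - by move=> x y [_ Wx] [_ [_ Wy]]; exact: sepW.
  - by apply: le_outer_measure => x [[Xx /WS/WS]|[Xx [Wx _]]].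
have mu2 : \sum_(i <oo) mu (X `&` D i) < +oo.
  apply: (@le_lt_trans _ _ (mu X + mu X)); last by rewrite lte_add_pinfty.
  apply: lime_le.
    by apply: is_cvg_nneseries => i _ _; exact: outer_measure_ge0.
  near=> k; have -> : k = k.-1.+1 by rewrite prednK//; near: k; exists 1%N.
  by apply: le_trans (sumD _) _; apply: leeD; apply: le_outer_measure => x [].
have tail : \sum_(j <= i <oo) mu (X `&` D i) @[j --> \oo] --> 0.
  by apply: nneseries_tail_cvg mu2 _ => i _; exact: outer_measure_ge0.
suff H k : mu (X `&` U) + mu (X `&` ~` U) <=
    mu X + \sum_(k <= i <oo) mu (X `&` D i).
  have muXfin : mu X \is a fin_num.
    by rewrite ge0_fin_numE// outer_measure_ge0.
  have lim : mu X + \sum_(k <= i <oo) mu (X `&` D i) @[k --> \oo] --> mu X.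
    rewrite -[X in _ --> X]adde0; apply: cvgeD => //; last exact: cvg_cst.
    by rewrite fin_num_adde_defr.
  rewrite -(cvg_lim _ lim)//; apply: lime_ge; last by near=> k; exact: H.
  by apply/cvg_ex; exists (mu X).
have UWD : X `&` U `<=` (X `&` W k) `|` \bigcup_i (X `&` D (i + k)%N).
  move=> x [Xx]; rewrite UW => -[m _].
  have [Wk|nWk] := pselect (W k x); first by left.
  have WSn i j : W i `<=` W (i + j)%N.
    elim: j => [|j ih]; first by rewrite addn0.
    by rewrite addnS; apply: subset_trans ih (WS _).
  elim: m => [W0|m ih Wm].
    by exfalso; apply: nWk; have := WSn 0%N k x W0; rewrite add0n.
  have [/ih//|nWm] := pselect (W m x).
  right; have km : (k <= m)%N.
    rewrite leqNgt; apply/negP => mk; apply: nWk.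
    by rewrite -(subnKC mk); exact: WSn.
  by exists (m - k)%N => //; rewrite subnK.
have h1 : mu (X `&` U) <= mu (X `&` W k) + \sum_(k <= i <oo) mu (X `&` D i).
  apply: le_trans (le_outer_measure mu _ _ UWD) _.
  apply: le_trans (outer_measureU2 _ _ _) _; apply: leeD2l.
  apply: le_trans (outer_measure_sigma_subadditive mu _) _.
  by rewrite (@nneseries_addn _ (fun i => mu (X `&` D i)))// => i;
    exact: outer_measure_ge0.
apply: le_trans (leeD2r _ h1) _.
rewrite addeAC leeD2r//.
apply: le_trans (mu_sep (e := r k) _ _) _ => //.
- by move=> x y [_ Wx] [_]; exact: Wx.
- by apply: le_outer_measure => x [[]|[]].
Unshelve. all: by end_near. Qed.

End metric_outer_measure.

Section hausdorff_theory.
Context (R : realType) (n k : nat).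
Implicit Types A B F : set 'rV[R]_n.
Local Open Scope ereal_scope.

Let gauge := @hausdorff_gauge R n k.
Let pre := @hausdorff_pre R n k.

Lemma ediam_le A B : A `<=` B -> ediam A <= ediam B.
Proof.
move=> AB; apply: ereal_sup_le => _ [x /AB ?] [y /AB ? <-].
by exists x => //; exists y.
Qed.

Lemma ediam_set0_le (e : R) : ediam (set0 : set 'rV[R]_n) <= e%:E.
Proof. by apply: ge_ereal_sup => _ [x []]. Qed.

Lemma hausdorff_gauge0 : gauge set0 = 0.
Proof. by rewrite /gauge /hausdorff_gauge eqxx. Qed.

Lemma hausdorff_gauge_ge0 A : 0 <= gauge A.
Proof.
rewrite /gauge /hausdorff_gauge; case: ifPn => // /set0P[x Ax].
apply: expe_ge0; apply: ereal_sup_ubound; exists x => //; exists x => //.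
by rewrite subrr enorm0.
Qed.

Let gauge_series_ge0 (F : (set 'rV[R]_n)^nat) : 0 <= \sum_(i <oo) gauge (F i).
Proof. by apply: nneseries_ge0 => i _ _; exact: hausdorff_gauge_ge0. Qed.

Lemma hausdorff_pre_ge0 e A : 0 <= pre e A.
Proof. by apply: le_ereal_inf_tmp => _ [F _ <-]; exact: gauge_series_ge0. Qed.

Lemma hausdorff_pre_le e A B : A `<=` B -> pre e A <= pre e B.
Proof.
move=> AB; apply: ereal_inf_le_tmp => _ [F [dF BF] <-]; exists F => //; split => //.
exact: subset_trans BF.
Qed.

Lemma hausdorff_pre_mono e e' A : (e <= e')%R -> pre e' A <= pre e A.
Proof.
move=> ee'; apply: ereal_inf_le_tmp => _ [F [dF BF] <-]; exists F => //; split => // i.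
by rewrite (le_trans (dF i))// lee_fin.
Qed.

Lemma hausdorff_pre_sigma_subadditive e : sigma_subadditive (pre e).
Proof.
move=> A; have [[i ioo]|] := pselect (exists i, pre e (A i) = +oo).
  rewrite (eseries_pinfty _ _ ioo) ?leey// => j _.
  by rewrite -ltNye (lt_le_trans _ (hausdorff_pre_ge0 _ _)).
rewrite -forallNE => Aoo.
suff add2e (d : {posnum R}) :
    pre e (\bigcup_n A n) <= \sum_(i <oo) pre e (A i) + d%:num%:E.
  by apply/lee_addgt0Pr => _/posnumP[].
rewrite (le_trans _ (epsilon_trick _ _ _))//; last first.
  by move=> j; exact: hausdorff_pre_ge0.
pose P j (B : (set 'rV[R]_n)^nat) :=
  ((forall i, ediam (B i) <= e%:E) /\ A j `<=` \bigcup_i B i) /\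
  \sum_(i <oo) gauge (B i) <= pre e (A j) + (d%:num / (2 ^ j.+1)%:R)%:E.
have [G PG] : {G : ((set 'rV[R]_n)^nat)^nat & forall j, P j (G j)}.
  apply: (@choice _ _ P) => j.
  have en1 : (0 < d%:num / (2 ^ j.+1)%:R :> R)%R by [].
  have : pre e (A j) \is a fin_num.
    by rewrite ge0_fin_numE ?hausdorff_pre_ge0// ltey; exact/eqP.
  move=> /(lb_ereal_inf_adherent en1)[_ [B [dB AB] <-] Bd].
  by exists B; split => //; exact/ltW.
have G_ge0 x : 0 <= (gauge \o uncurry G) x by exact: hausdorff_gauge_ge0.
apply: (@le_trans _ _ (\esum_(i in setT) (gauge \o uncurry G) i)).
  apply: ereal_inf_lbound => /=.
  have /card_esym/ppcard_eqP[f] := card_nat2.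
  exists (uncurry G \o f).
    split => [i /=|t [i _]].
      by case: (f i) => a b; exact: (PG a).1.1.
    move=> /(PG i).1.2 [j _ Bijt]; exists (f^-1%FUN (i, j)) => //=.
    by rewrite invK ?inE.
  rewrite -(esum_pred_image (gauge \o uncurry G) _ xpredT) ?[fun=> _]set_true//.
  by rewrite image_eq.
rewrite (_ : esum _ _ = \sum_(i <oo) \sum_(j <oo) gauge (G i j)); last first.
  pose J : nat -> set (nat * nat) := fun i => [set (i, j) | j in setT].
  rewrite (_ : setT = \bigcup_k J k); last first.
    by rewrite predeqE => -[a b]; split => // _; exists a => //; exists b.
  rewrite esum_bigcupT /=; last 2 first.
    - apply/trivIsetP => i j _ _ ij.
      rewrite predeqE => -[a m] /=; split => //= -[] [_] _ [<-{a} _].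
      by move=> [m' _] [] /esym/eqP; rewrite (negbTE ij).
    - by move=> /= [a m]; exact: hausdorff_gauge_ge0.
  rewrite -(image_id [set: nat]) -fun_true esum_pred_image//; last first.
    by move=> j _; apply: esum_ge0 => x _; exact: G_ge0.
  apply: eq_eseriesr => /= j _.
  rewrite -(esum_pred_image (gauge \o uncurry G) (pair j) predT)//=; last 2 first.
  - by move=> m _; exact: hausdorff_gauge_ge0.
  - by move=> ? ? _ _; exact: (@can_inj _ _ _ snd).
  by congr esum; rewrite predeqE => -[a b]; split; move=> [i _ <-]; exists i.
apply: lee_lim.
- by apply: is_cvg_nneseries => j _ _; exact: gauge_series_ge0.
- apply: is_cvg_nneseries => j _ _; apply: adde_ge0 => //.
  exact: hausdorff_pre_ge0.
- by near=> m; apply: lee_sum => i _; exact: (PG i).2.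
Unshelve. all: by end_near. Qed.

Let hausdorff0 : hausdorff k (set0 : set 'rV[R]_n) = 0.
Proof.
apply/eqP; rewrite eq_le; apply/andP; split.
  apply: ge_ereal_sup => _ [e e0 <-]; apply: ereal_inf_lbound.
  exists (fun=> set0); first by split => // i; exact: ediam_set0_le.
  by apply: eseries0 => i _ _; exact: hausdorff_gauge0.
apply: le_trans (hausdorff_pre_ge0 1 set0) _; apply: ereal_sup_ubound.
by exists 1%R => /=.
Qed.

Let hausdorff_ge0 A : 0 <= hausdorff k A.
Proof.
apply: le_trans (hausdorff_pre_ge0 1 A) _; apply: ereal_sup_ubound.
by exists 1%R => /=.
Qed.

Let le_hausdorff : {homo @hausdorff R n k : A B / A `<=` B >-> A <= B}.
Proof.
move=> A B AB; apply: ge_ereal_sup => _ [e e0 <-].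
apply: le_trans (hausdorff_pre_le e AB) _.
by apply: ereal_sup_ubound; exists e.
Qed.

Let hausdorff_sigma_subadditive : sigma_subadditive (@hausdorff R n k).
Proof.
move=> A; apply: ge_ereal_sup => _ [e e0 <-].
apply: le_trans (hausdorff_pre_sigma_subadditive e A) _.
apply: lee_nneseries => [i _ _|i _]; first exact: hausdorff_pre_ge0.
by apply: ereal_sup_ubound; exists e.
Qed.

HB.instance Definition _ := isOuterMeasure.Build R _ (@hausdorff R n k)
  hausdorff0 hausdorff_ge0 le_hausdorff hausdorff_sigma_subadditive.

Lemma hausdorff_pre_sep A B (e d : R) : (d < e)%R ->
  (forall x y, A x -> B y -> (e <= enorm (x - y))%R) ->
  pre d A + pre d B <= pre d (A `|` B).
Proof.
move=> de sepAB; apply: le_ereal_inf_tmp => _ [F [dF ABF] <-].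
pose G C i := if pselect (exists2 x, C x & F i x) then F i else set0.
have dG C i : ediam (G C i) <= d%:E.
  by rewrite /G; case: pselect => ?; [exact: dF|exact: ediam_set0_le].
have cG C : C `<=` A `|` B -> C `<=` \bigcup_i G C i.
  move=> CAB x Cx; have /ABF[i _ Fx] : (A `|` B) x by exact: CAB.
  exists i => //.
  by rewrite /G; case: pselect => // -[]; exists x.
apply: (@le_trans _ _
    (\sum_(i <oo) gauge (G A i) + \sum_(i <oo) gauge (G B i))).
  apply: leeD; apply: ereal_inf_lbound.
    by exists (G A) => //; split => //; apply: cG => x; left.
  by exists (G B) => //; split => //; apply: cG => x; right.
rewrite -nneseriesD; try by move=> i _ _; exact: hausdorff_gauge_ge0.
apply: lee_nneseries => [i _ _|i _].
  by apply: adde_ge0; exact: hausdorff_gauge_ge0.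
rewrite /G; case: pselect => [[x Ax Fx]|?]; case: pselect => [[y By Fy]|?];
  rewrite ?hausdorff_gauge0 ?adde0 ?add0e//; last exact: hausdorff_gauge_ge0.
exfalso; have := sepAB _ _ Ax By; apply/negP; rewrite -ltNge.
apply: le_lt_trans de; rewrite -lee_fin; apply: le_trans (dF i).
by apply: ereal_sup_ubound; exists x => //; exists y.
Qed.

Lemma hausdorff_sep A B (e : R) : (0 < e)%R ->
  (forall x y, A x -> B y -> (e <= `|x - y|)%R) ->
  hausdorff k A + hausdorff k B <= hausdorff k (A `|` B).
Proof.
move=> e0 sepAB; set h := hausdorff k (_ `|` _).
have key d1 d2 : (0 < d1)%R -> (0 < d2)%R -> pre d1 A + pre d2 B <= h.
  move=> d10 d20; pose d := Num.min (Num.min d1 d2) (e / 2)%R.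
  have d0 : (0 < d)%R by rewrite /d !lt_min d10 d20 divr_gt0.
  apply: (@le_trans _ _ (pre d (A `|` B))); last first.
    by apply: ereal_sup_ubound; exists d.
  apply: le_trans (hausdorff_pre_sep (e := e) _ _).
  - by apply: leeD; apply: hausdorff_pre_mono; rewrite /d !ge_min lexx ?orbT.
  - by rewrite /d gt_min ltr_pdivrMr// ltr_pMr// ltr1n orbT.
  - by move=> x y Ax By; rewrite (le_trans (sepAB _ _ Ax By))// ler_norm_enorm.
have [->|hoo] := eqVneq h +oo; first by rewrite leey.
have {}hoo : h < +oo by rewrite ltey.
have fpre C d : C `<=` A `|` B -> (0 < d)%R -> pre d C \is a fin_num.
  move=> CAB d0; rewrite ge0_fin_numE ?hausdorff_pre_ge0//.
  apply: le_lt_trans hoo; apply: le_trans (hausdorff_pre_le d CAB) _.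
  by apply: ereal_sup_ubound; exists d.
have fB : hausdorff k B \is a fin_num.
  rewrite ge0_fin_numE; last exact: hausdorff_ge0.
  by apply: le_lt_trans hoo; apply: le_hausdorff => x; right.
rewrite -leeBrDr//; apply: ge_ereal_sup => _ [d1 /= d10 <-].
rewrite leeBrDr// addeC -leeBrDr; last by apply: fpre => // x; left.
apply: ge_ereal_sup => _ [d2 /= d20 <-].
rewrite leeBrDr; last by apply: fpre => // x; left.
by rewrite addeC key.
Qed.

Lemma borel_caratheodory (A : set (borelRn R n)) :
  measurable A -> (@hausdorff R n k).-caratheodory A.
Proof.
move: A; apply: smallest_sub.
  split; first exact: caratheodory_measurable_set0.
    by move=> A mA; rewrite setTD; exact: caratheodory_measurable_setC.
  by move=> F mF; exact: caratheodory_measurable_bigcup.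
by move=> U; apply: open_caratheodory; exact: hausdorff_sep.
Qed.

Let hausdorff_borel0 : (@hausdorff R n k : set (borelRn R n) -> _) set0 = 0.
Proof. exact: hausdorff0. Qed.

Let hausdorff_borel_ge0 (A : set (borelRn R n)) : 0 <= hausdorff k A.
Proof. exact: hausdorff_ge0. Qed.

Let hausdorff_borel_sigma_additive :
  semi_sigma_additive (@hausdorff R n k : set (borelRn R n) -> _).
Proof.
move=> F mF tF _.
apply: (@caratheodory_measure_sigma_additive _ _ (@hausdorff R n k)) => //.
  by move=> i; exact: borel_caratheodory.
by apply: caratheodory_measurable_bigcup => i; exact: borel_caratheodory.
Qed.

HB.instance Definition _ := isMeasure.Build _ (borelRn R n) R
  (@hausdorff R n k : set (borelRn R n) -> \bar R)
  hausdorff_borel0 hausdorff_borel_ge0 hausdorff_borel_sigma_additive.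

Definition hausdorff_measure : {measure set (borelRn R n) -> \bar R} :=
  (@hausdorff R n k : set (borelRn R n) -> \bar R).

End hausdorff_theory.
Arguments hausdorff_measure : clear implicits.

(* sigma_{n-1}. As 0 < H^{n-1}(S^{n-1}) < +oo for n >= 1, the default value
   \d_0 required by mnormalize plays no role. *)
Definition sphere_uniform (R : realType) (n : nat) : probability (borelRn R n) R :=
  mnormalize (mrestr (hausdorff_measure R n n.-1) (@measurable_sphere R n))
    (dirac (0 : borelRn R n)).

(* Borel probability measures on the sphere are represented by the Borel
   probability measures on R^n that are carried by the sphere. *)
Definition P0 (R : realType) (n : nat) : set (probability (borelRn R n) R) :=
  [set mu : probability (borelRn R n) R | mu (sphere R n) = 1%E /\
    forall i : 'I_n, (\int[mu]_(v in sphere R n) ((v : 'rV[R]_n) ord0 i)%:E = 0)%E].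
Arguments P0 : clear implicits.

Definition J (R : realType) (n : nat) (p : R)
    (mu : probability (borelRn R n) R) : \bar R :=
  (\int[mu]_(w in sphere R n) \int[mu]_(v in sphere R n)
     (enorm ((v : 'rV[R]_n) - (w : 'rV[R]_n)) `^ p)%:E)%E.

Definition c_inf (R : realType) (n : nat) (p : R) : \bar R :=
  ereal_inf [set J p mu | mu in P0 R n].

Definition C_sup (R : realType) (n : nat) (p : R) : \bar R :=
  ereal_sup [set J p mu | mu in P0 R n].

(* Main.v *)
Require Import Defs.
From HB Require Import structures.
From mathcomp Require Import all_boot all_order all_algebra.
From mathcomp Require Import all_classical all_reals all_analysis.
From mathcomp Require Import measurable_realfun zify ring lra.
Import Order.TTheory GRing.Theory Num.Theory numFieldNormedType.Exports.
Local Open Scope classical_set_scope.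
Local Open Scope ring_scope.
Set Implicit Arguments.
Unset Strict Implicit.
Unset Printing Implicit Defensive.

(** For unit vectors, |v - w|^p = (2 - 2t)^(p/2) with t = <v, w>, so that J_p is
the energy of a measure for a kernel that depends only on the inner product.

Minimum. Since p/2 < 1, the function u^(p/2) is strictly concave on [0, 4] and
lies above its chord: (2 - 2t)^(p/2) >= 2^(p-1) (1 - t) on [-1, 1], with equality
only at t = 1 and t = -1 ([riesz_chord], [riesz_chord_eq]). The double integral of
t is the squared norm of the barycenter, which is 0, so integrating gives
J_p(mu) >= 2^(p-1) ([kernel_energy_ge]). In case of equality, there is a w such
that almost every v has <v, w> = 1 or -1, that is v = w or v = -w
([kernel_energy_eq]); as the barycenter is 0, both points have mass 1/2
([ae_antipodal_half]). Conversely such a measure attains the bound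
([J_two_point]).

Maximum. The kernel (1 - t)^a with 0 < a < 1 is, up to a constant, the opposite of
a positive definite kernel: it is a uniform limit of polynomials in t whose
coefficients of positive degree are nonpositive, obtained from the binomial series
([powR_poly_approx]). For the kernel t^k, the mutual energy of two measures is the
inner product of their vectors of moments of degree k, hence the energy of a
difference is a sum of squares. When sigma is invariant under rotations, its
potential is constant on the sphere, so the mutual energy of mu and sigma is the
energy of sigma, and the sum of squares says that the energy of mu is at least that
of sigma ([gramX_energy_min]). The sign of the coefficients reverses the inequality,
and the uniform limit gives J_p(mu) <= J_p(sigma) ([kernel_energy_max]).

It remains that the normalized Hausdorff measure is a rotation invariant
probability measure on the sphere. Invariance holds because isometries preserve
diameters. Normalization requires that the Hausdorff measure of the sphere be finite
([hausdorff_sphere_lty]), which is shown by explicit covers by O(N^(n-1)) pieces of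
diameter O(1/N), and positive ([hausdorff_sphere_gt0]), which is shown by counting
the points of a fine grid that a small ball can contain. *)

(** * Polynomial approximation of (1 - t)^a *)

Section binomial_series.
Variables (R : realType) (a : R).
Hypothesis a01 : 0 < a < 1.

(** The coefficient of t^k in the binomial series of (1 - t)^a. *)
Fixpoint binc (k : nat) : R :=
  if k is k'.+1 then binc k' * (k'%:R - a) / k%:R else 1.

Arguments binc : simpl never.

Definition binS (N : nat) : {poly R} := \poly_(k < N.+1) binc k.

Lemma bincS k : k.+1%:R * binc k.+1 = (k%:R - a) * binc k.
Proof. by rewrite /binc mulrCA divff ?pnatr_eq0// mulr1 mulrC. Qed.

(** One has k b_k = (k - 1 - a) b_(k-1), where the factor lies between 0 and
k - 1 for k >= 2. Hence the sign of b_1 = - a persists and k |b_k| does not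
increase, which is the uniform bound needed on the remainder of the series. *)
Lemma binc_bound k : - a <= k.+1%:R * binc k.+1 <= 0.
Proof.
have /andP[a0 a1] := a01.
elim: k => [|k /andP[ih1 ih2]]; first by rewrite bincS /binc; lra.
have k0 : (0 : R) <= k%:R by [].
have b0 : binc k.+1 <= 0 by rewrite -(pmulr_rle0 (x := k.+1%:R)).
rewrite bincS; move: ih1 ih2; rewrite -natr1; set b := binc k.+1 in b0 *.
by move=> *; apply/andP; split; nra.
Qed.

Lemma binc_le0 k : (0 < k)%N -> binc k <= 0.
Proof.
case: k => // k _; have /andP[_] := binc_bound k.
by rewrite pmulr_rle0.
Qed.

Lemma binSS N : binS N.+1 = binS N + (binc N.+1)%:P * 'X^(N.+1).
Proof.
rewrite /binS !poly_def big_ord_recr /=; congr (_ + _).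
by rewrite mul_polyC.
Qed.

(** The function (1 - t)^a solves (1 - t) y' + a y = 0; a partial sum of its
series solves the same equation up to one monomial of top degree. *)
Lemma binS_ode N (x : R) :
  (1 - x) * ((binS N)^`()).[x] + a * (binS N).[x] =
  (a - N%:R) * binc N * x ^+ N.
Proof.
elim: N => [|N ih].
  have -> : binS 0 = 1 by rewrite /binS poly_def big_ord_recl big_ord0 /= addr0 scale1r.
  by rewrite derivC !hornerC /binc expr0; ring.
have := bincS N; rewrite binSS -natr1.
move: (binc N.+1) (binc N) ih => b c ih bN.
rewrite derivD deriv_mulC derivXn !hornerE hornerMn !hornerE exprS.
rewrite -mulr_natl -[N.+1.-1]/N -natr1.
move: (x ^+ N) (binS N).[x] (binS N)^`().[x] ih => y S S' ih.
have -> : (1 - x) * (S' + b * ((N%:R + 1) * y)) + a * (S + b * (x * y)) =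
  ((1 - x) * S' + a * S) + (1 - x) * ((N%:R + 1) * b) * y + a * b * x * y by ring.
have cE : (a - N%:R) * c = - ((N%:R + 1) * b) by rewrite bN; ring.
by rewrite ih cE; ring.
Qed.

Let g N (t s : R) := (binS N).[s * t] * (1 - s * t) `^ (- a).

(** By the differential equation, the quotient of a partial sum by (1 - t)^a
has a derivative of order t^N, so it stays close to its value 1 at 0. *)
Let g_derive N (t s : R) : `|s * t| < 1 ->
  is_derive s 1 (g N t) (t * ((a - N%:R) * binc N * (s * t) ^+ N *
    (1 - s * t) `^ (- a - 1))).
Proof.
move=> st1; have st0 : 0 < 1 - s * t by rewrite subr_gt0 (le_lt_trans (ler_norm _)).
have d1 : is_derive s 1 (fun s => s * t) t.
  have -> : (fun s => s * t) = t \*: id by apply/funext => x; rewrite /= /GRing.scale /= mulrC.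
  by apply: is_derive_eq; rewrite /GRing.scale /= mulr1.
have d2 : is_derive s 1 (fun s => 1 - s * t) (- t).
  have -> : (fun s => 1 - s * t) = cst 1 - (fun s => s * t) by [].
  by apply: is_derive_eq; rewrite sub0r.
have d3 := @is_derive1_comp _ (fun u : R => u `^ (- a)) (fun s : R => 1 - s * t) s _ _
  (is_derive1_powR (- a) st0) d2.
have d4 := @is_derive1_comp _ (horner (binS N)) (fun s : R => s * t) s _ _
  (is_derive_poly (binS N) (s * t)) d1.
have d5 := is_deriveM d4 d3.
apply: (@is_derive_eq _ _ _ _ _ _ _ _ d5).
rewrite /GRing.scale /= -binS_ode.
have -> : (1 - s * t) `^ (- a) = (1 - s * t) * (1 - s * t) `^ (- a - 1).
  have sn0 : 1 - s * t != 0 by rewrite gt_eqF.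
  by rewrite (@powRB _ _ (- a) 1) ?sn0 ?implybT// powRr1 ?ltW// mulrCA divff ?mulr1.
by ring.
Qed.

Let g_dist N (t r : R) : 0 <= r < 1 -> `|t| <= r ->
  `|g N t 1 - 1| <= a * (1 - r) `^ (- a - 1) * r ^+ N.
Proof.
move=> /andP[r0 r1] tr; have /andP[a0 a1] := a01.
have str (s : R) : s \in `[0, 1]%R -> `|s * t| <= r.
  rewrite in_itv /= => /andP[s0 s1]; rewrite normrM (ger0_norm s0).
  by rewrite (le_trans _ tr)// ler_piMl.
have stlt (s : R) : s \in `[0, 1]%R -> `|s * t| < 1 by move=> /str /le_lt_trans; apply.
have gD (s : R) : s \in `]0, 1[%R ->
  is_derive s 1 (g N t) (t * ((a - N%:R) * binc N * (s * t) ^+ N *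
    (1 - s * t) `^ (- a - 1))).
  by move=> s01; apply: g_derive; apply: stlt; apply: subset_itv_oo_cc.
have gC : {within `[0, 1], continuous (g N t)}.
  apply: derivable_within_continuous => s s01.
  by have [] := g_derive N (stlt s s01).
have [c c01 gc] := MVT_segment ler01 gD gC.
have g0 : g N t 0 = 1.
  by rewrite /g mul0r subr0 powR1 mulr1 horner_coef0 coef_poly.
have -> : g N t 1 - 1 = g N t 1 - g N t 0 by rewrite g0.
rewrite gc subr0 mulr1 !normrM.
have -> : a * (1 - r) `^ (- a - 1) * r ^+ N = 1 * (a * r ^+ N * (1 - r) `^ (- a - 1)) by ring.
apply: ler_pM => //; rewrite ?mulr_ge0//.
  by rewrite (le_trans tr) ?ltW.
apply: ler_pM => //; rewrite ?mulr_ge0//.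
  apply: ler_pM => //; rewrite ?mulr_ge0//.
    rewrite -normrM -normrN -mulNr opprB -bincS.
    by have /andP[? ?] := binc_bound N; rewrite ler0_norm// lerNl.
  by rewrite normrX lerXn2r// ?nnegrE// str.
have cr := str _ c01.
have c0 : 1 - r <= 1 - c * t by rewrite lerD2l lerN2 (le_trans (ler_norm _)).
have r0' : 0 < 1 - r by rewrite subr_gt0.
rewrite ger0_norm ?powR_ge0// -[- a - 1]opprK !(powRN _ (- (_ - _))).
rewrite lef_pV2 ?posrE ?powR_gt0// ?(lt_le_trans _ c0)//.
apply: ge0_ler_powR; rewrite ?nnegrE ?(ltW r0') ?(le_trans _ c0) ?(ltW r0')//.
lra.
Qed.

(** Convergence of the series away from the end points, from the mean value
theorem applied to the quotient of a partial sum by (1 - t)^a. *)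
Lemma binS_approx (r e : R) : 0 <= r < 1 -> 0 < e ->
  exists N, forall t, `|t| <= r -> `|(binS N).[t] - (1 - t) `^ a| <= e.
Proof.
move=> r01 e0; have /andP[r0 r1] := r01; have /andP[a0 a1] := a01.
pose K := 2 * (a * (1 - r) `^ (- a - 1)) + 1.
have K0 : 0 < K.
  by rewrite /K ltr_wpDl// !mulr_ge0 ?powR_ge0// ltW.
have : r ^+ N @[N --> \oo] --> 0 by apply: cvg_expr; rewrite ger0_norm.
move=> /cvgrPdist_le /(_ (e / K)) []; first by rewrite divr_gt0.
move=> N _ /(_ N (leqnn N)); rewrite sub0r normrN ger0_norm ?exprn_ge0// => rN.
exists N => t tr.
have t1 : 0 < 1 - t by rewrite subr_gt0 (le_lt_trans (ler_norm _)) ?(le_lt_trans tr).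
have := g_dist N r01 tr; rewrite /g !mul1r powRN => gd.
have pa : 0 < (1 - t) `^ a by rewrite powR_gt0.
have -> : (binS N).[t] - (1 - t) `^ a =
   ((binS N).[t] / (1 - t) `^ a - 1) * (1 - t) `^ a.
  by rewrite mulrBl divfK ?gt_eqF// mul1r.
rewrite normrM (gtr0_norm pa).
have pa2 : (1 - t) `^ a <= 2.
  have t2 : 1 - t <= 2.
    by have := le_trans tr (ltW r1); rewrite ler_norml => /andP[? ?]; lra.
  apply: (@le_trans _ _ (2 `^ a)).
    by apply: ge0_ler_powR; rewrite ?nnegrE// ltW.
  by apply: ler1_powR; [lra|exact: ltW].
apply: (@le_trans _ _ (a * (1 - r) `^ (- a - 1) * r ^+ N * 2)).
  by apply: ler_pM => //; exact: ltW.
apply: (@le_trans _ _ (K * r ^+ N)); last by rewrite -ler_pdivlMl// mulrC.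
by rewrite mulrAC ler_wpM2r ?exprn_ge0// /K mulrC lerDl.
Qed.

Lemma powR_subadd (x y : R) : 0 <= x -> 0 <= y ->
  (x + y) `^ a <= x `^ a + y `^ a.
Proof.
have /andP[a0 a1] := a01.
move=> x0 y0; have [/eqP|xy0] := eqVneq (x + y) 0.
  by rewrite paddr_eq0// => /andP[/eqP -> /eqP ->]; rewrite addr0 lerDl powR_ge0.
have {}xy0 : 0 < x + y by rewrite lt0r xy0 addr_ge0.
have key z : 0 <= z -> z <= x + y -> (x + y) `^ a * (z / (x + y)) <= z `^ a.
  move=> z0 zxy; have [->|zn0] := eqVneq z 0; first by rewrite mul0r mulr0 powR_ge0.
  have zp : 0 < z by rewrite lt0r zn0.
  rewrite -{2}[z](divfK (lt0r_neq0 xy0)) powRM ?divr_ge0 ?(ltW xy0)// mulrC.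
  rewrite ler_wpM2r ?powR_ge0// ger1_powR ?(ltW a1)// divr_gt0//=.
  by rewrite ler_pdivrMr// mul1r.
rewrite -[leLHS]mulr1 -[X in _ * X](@divff _ (x + y)) ?gt_eqF// mulrDl mulrDr.
by rewrite lerD// key// ?lerDl ?lerDr.
Qed.

Lemma powR_dist (x y : R) : 0 <= x -> 0 <= y ->
  `|x `^ a - y `^ a| <= `|x - y| `^ a.
Proof.
have /andP[a0 a1] := a01.
wlog xy : x y / x <= y => [hw x0 y0|x0 y0].
  have [/hw|/ltW/hw] := leP x y; first exact.
  by rewrite distrC (distrC x); exact.
rewrite distrC (distrC x) !ger0_norm ?subr_ge0//.
  rewrite lerBlDr addrC -{1}(subrK x y) addrC powR_subadd ?subr_ge0//.
by apply: ge0_ler_powR; rewrite ?nnegrE// ltW.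
Qed.

(** The function (1 - t)^a is a uniform limit, on the closed interval, of
polynomials whose coefficients of positive degree are nonpositive. The end
point t = 1 is reached by dilating the variable: (1 - r t)^a is close to
(1 - t)^a when r is close to 1, because u^a is Hoelder continuous. *)
Lemma powR_poly_approx (e : R) : 0 < e ->
  exists2 Q : {poly R}, (forall k, (0 < k)%N -> Q`_k <= 0) &
    forall t, `|t| <= 1 -> `|Q.[t] - (1 - t) `^ a| <= e.
Proof.
move=> e0; have /andP[a0 a1] := a01.
pose d := Num.min (1 / 2) ((e / 2) `^ a^-1).
have d0 : 0 < d by rewrite /d lt_min divr_gt0//= powR_gt0// divr_gt0.
have d1 : d < 1 by rewrite /d gt_min; apply/orP; left; lra.
pose r := 1 - d.
have r01 : 0 <= r < 1 by rewrite /r; apply/andP; split; lra.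
have /andP[r0 r1] := r01.
have [N HN] := binS_approx r01 (divr_gt0 e0 (ltr0n _ 2)).
exists (binS N \Po (r *: 'X)).
  move=> k k0; rewrite (_ : _`_k = r ^+ k * (binS N)`_k).
    rewrite mulr_ge0_le0 ?exprn_ge0// coef_poly; case: ifP => // _; exact: binc_le0.
  rewrite comp_polyE coef_sum; have [kN|kN] := ltnP k (size (binS N)).
    rewrite (bigD1 (Ordinal kN))//= big1 => [|i ik].
      by rewrite addr0 coefZ exprZn coefZ coefXn eqxx mulr1 mulrC.
    rewrite coefZ exprZn coefZ coefXn; case: eqP => [ki|]; last by rewrite !mulr0.
    by case/eqP: ik; apply/val_inj.
  rewrite [in RHS]nth_default// mulr0 big1// => i _.
  rewrite coefZ exprZn coefZ coefXn gtn_eqF ?mulr0//.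
  exact: leq_trans (ltn_ord i) kN.
move=> t t1; rewrite horner_comp hornerZ hornerX.
have rtr : `|r * t| <= r by rewrite normrM (ger0_norm r0) ler_piMr.
rewrite -(subrKA ((1 - r * t) `^ a)) (le_trans (ler_normD _ _))//.
rewrite [leRHS](splitr e) lerD ?HN//.
have : `|r * t| <= 1 by rewrite (le_trans rtr) ?ltW.
move=> /ler_normlW rt1; have tt1 := ler_normlW t1.
apply: le_trans (powR_dist _ _) _; rewrite ?subr_ge0//.
have -> : 1 - r * t - (1 - t) = d * t by rewrite /r; ring.
apply: (@le_trans _ _ (d `^ a)).
  apply: ge0_ler_powR; rewrite ?nnegrE// ?(ltW a0) ?(ltW d0)//.
  by rewrite normrM (gtr0_norm d0) ler_piMr ?(ltW d0).
apply: (@le_trans _ _ (((e / 2) `^ a^-1) `^ a)).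
  apply: ge0_ler_powR; rewrite ?nnegrE// ?(ltW a0) ?(ltW d0) ?powR_ge0//.
  by rewrite /d ge_min lexx orbT.
by rewrite -powRrM mulVf ?gt_eqF// powRr1// divr_ge0 ?(ltW e0).
Qed.

End binomial_series.

(** * Euclidean geometry of row vectors *)

Section euclidean.
Context (R : realType) (n : nat).
Implicit Types x y v w : 'rV[R]_n.

Definition dotp v w : R := \sum_(i < n) v ord0 i * w ord0 i.

Lemma dotpC v w : dotp v w = dotp w v.
Proof. by apply: eq_bigr => i _; rewrite mulrC. Qed.

Lemma dotpDl u v w : dotp (u + v) w = dotp u w + dotp v w.
Proof. by rewrite -big_split; apply: eq_bigr => i _; rewrite mxE mulrDl. Qed.

Lemma dotpZl (c : R) v w : dotp (c *: v) w = c * dotp v w.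
Proof. by rewrite mulr_sumr; apply: eq_bigr => i _; rewrite mxE mulrA. Qed.

Lemma dotpNl v w : dotp (- v) w = - dotp v w.
Proof. by rewrite -scaleN1r dotpZl mulN1r. Qed.

Lemma dotpNr v w : dotp w (- v) = - dotp w v.
Proof. by rewrite dotpC dotpNl dotpC. Qed.

Lemma dotpDr u v w : dotp w (u + v) = dotp w u + dotp w v.
Proof. by rewrite !(dotpC w) dotpDl. Qed.

Lemma dotpZr (c : R) v w : dotp w (c *: v) = c * dotp w v.
Proof. by rewrite dotpC dotpZl dotpC. Qed.

Lemma dotpvv_ge0 v : 0 <= dotp v v.
Proof. by apply: sumr_ge0 => i _; rewrite -expr2 sqr_ge0. Qed.

Lemma enormE v : enorm v = Num.sqrt (dotp v v).
Proof. by rewrite /enorm; congr Num.sqrt; apply: eq_bigr => i _; rewrite expr2. Qed.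

Lemma enorm_sqr v : enorm v ^+ 2 = dotp v v.
Proof. by rewrite enormE sqr_sqrtr// dotpvv_ge0. Qed.

Lemma dotpvv_eq0 v : dotp v v = 0 -> v = 0.
Proof.
move=> /eqP; rewrite psumr_eq0 => [/allP v0|i _]; last by rewrite -expr2 sqr_ge0.
apply/rowP => i; rewrite mxE; apply/eqP.
by have := v0 i (mem_index_enum _); rewrite mulf_eq0 orbb.
Qed.

(** The form in which membership in the sphere is used: it is free of square
roots. *)
Lemma sphere_dotp v : sphere R n v <-> dotp v v = 1.
Proof.
rewrite /sphere /= -enorm_sqr; split => [->|/eqP]; first by rewrite expr1n.
by rewrite sqrf_eq1 => /orP[/eqP//|/eqP vN]; have := enorm_ge0 v; rewrite vN ler0N1.
Qed.

Lemma enorm_le_coord v (c : R) : 0 <= c ->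
  (forall i, `|v ord0 i| <= c) -> enorm v <= n%:R * c.
Proof.
move=> c0 vc; rewrite -ler_sqr ?nnegrE ?enorm_ge0 ?mulr_ge0// enorm_sqr.
apply: (@le_trans _ _ (\sum_(i < n) c ^+ 2)).
  by apply: ler_sum => i _; rewrite -expr2 -real_normK ?num_real// lerXn2r ?nnegrE.
rewrite big_const_ord iter_addr_0 exprMn -[leLHS]mulr_natl ler_wpM2r ?sqr_ge0//.
by rewrite -natrX ler_nat -mulnn; case: (n) => // k; rewrite leq_pmulr.
Qed.

(** The orthogonal reflection that changes the sign of u; the identity if u = 0. *)
Definition reflection (u x : 'rV[R]_n) : 'rV[R]_n :=
  x - (2 * dotp x u / dotp u u) *: u.

Lemma reflection_isometry u x y :
  enorm (reflection u x - reflection u y) = enorm (x - y).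
Proof.
have -> : reflection u x - reflection u y = reflection u (x - y).
  by rewrite /reflection dotpDl dotpNl; apply/rowP => i; rewrite !mxE; ring.
rewrite !enormE; congr Num.sqrt; move: (x - y) => z.
have [u0|u0] := eqVneq (dotp u u) 0.
  by rewrite /reflection (dotpvv_eq0 u0) scaler0 subr0.
rewrite /reflection dotpDl !dotpDr !dotpNl !dotpNr !dotpZl !dotpZr (dotpC u z).
by field.
Qed.

Lemma reflectionK u : involutive (reflection u).
Proof.
move=> x; have [u0|u0] := eqVneq (dotp u u) 0.
  by rewrite /reflection (dotpvv_eq0 u0) !scaler0 !subr0.
rewrite {1}/reflection; have -> : dotp (reflection u x) u = - dotp x u.
  by rewrite /reflection dotpDl dotpNl dotpZl divfK//; ring.
by rewrite mulrN mulNr scaleNr opprK /reflection subrK.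
Qed.

(** The reflections act transitively on the sphere, so that invariance under
reflections can replace invariance under the whole orthogonal group. *)
Lemma reflection_swap v w : sphere R n v -> sphere R n w ->
  reflection (v - w) v = w.
Proof.
move=> /sphere_dotp v1 /sphere_dotp w1.
have [vw|vw] := eqVneq (dotp (v - w) (v - w)) 0.
  rewrite /reflection (dotpvv_eq0 vw) scaler0 subr0.
  by apply/eqP; rewrite -subr_eq0 (dotpvv_eq0 vw).
have c1 : 2 * dotp v (v - w) / dotp (v - w) (v - w) = 1.
  apply: (mulIf vw); rewrite divfK// mul1r.
  by rewrite !dotpDl !dotpDr !dotpNl !dotpNr v1 w1 (dotpC w v); ring.
by rewrite /reflection c1 scale1r opprB addrC subrK.
Qed.

Lemma isometry_dotp (g : 'rV[R]_n -> 'rV[R]_n) x y :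
  (forall x y, enorm (g x - g y) = enorm (x - y)) -> g 0 = 0 ->
  dotp (g x) (g y) = dotp x y.
Proof.
move=> gE g0.
have gn z : dotp (g z) (g z) = dotp z z.
  by have := gE z 0; rewrite g0 !subr0 -!enorm_sqr => ->.
have := congr1 (fun t => t ^+ 2) (gE x y).
rewrite !enorm_sqr !dotpDl !dotpDr !dotpNl !dotpNr !gn (dotpC (g y) (g x)) (dotpC y x).
by move=> h; lra.
Qed.

Lemma opp_isometry (x y : 'rV[R]_n) : enorm (- x - - y) = enorm (x - y).
Proof. by rewrite !enormE -opprD dotpNl dotpNr opprK. Qed.

Lemma isometry_preimage_sphere (g : 'rV[R]_n -> 'rV[R]_n) :
  (forall x y, enorm (g x - g y) = enorm (x - y)) -> g 0 = 0 ->
  g @^-1` sphere R n = sphere R n.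
Proof.
move=> gE g0; have gn x : enorm (g x) = enorm x.
  by have := gE x 0; rewrite g0 !subr0.
by apply/seteqP; split => x; rewrite /sphere /= gn.
Qed.

End euclidean.

(** * Hausdorff measure: isometries, and finiteness on the sphere *)

Section hausdorff_upper.
Context (R : realType).

Lemma ediam_le_real n (A : set 'rV[R]_n) (d : R) :
  (forall x y, A x -> A y -> enorm (x - y) <= d) -> (ediam A <= d%:E)%E.
Proof.
by move=> Ad; apply: ge_ereal_sup => _ [x Ax [y Ay <-]]; rewrite lee_fin Ad.
Qed.

Lemma le_expe (x y : \bar R) k : (0 <= x -> x <= y -> x ^+ k <= y ^+ k)%E.
Proof.
move=> x0 xy; elim: k => // k ih.
by rewrite !expeS lee_pmul// expe_ge0.
Qed.

(** An isometry maps a cover to a cover with the same diameters. *)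
Lemma hausdorff_isometry_le n k (g : 'rV[R]_n -> 'rV[R]_n) (A : set 'rV[R]_n) :
  (forall x y, enorm (g x - g y) = enorm (x - y)) ->
  (hausdorff k (g @` A) <= hausdorff k A)%E.
Proof.
move=> gE; apply: ge_ereal_sup => _ [e e0 <-].
apply: (@le_trans _ _ (hausdorff_pre k e A)); last first.
  by apply: ereal_sup_ubound; exists e.
have dg F : ediam (g @` F) = ediam F.
  congr ereal_sup; apply/seteqP; split => z.
    by move=> [_ [x Fx <-] [_ [y Fy <-] <-]]; exists x => //; exists y => //; rewrite gE.
  move=> [x Fx [y Fy <-]]; exists (g x); first by exists x.
  by exists (g y); [exists y|rewrite gE].
apply: le_ereal_inf_tmp => _ [F [dF AF] <-].
apply: ereal_inf_lbound; exists (fun i => g @` F i).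
  split=> [i|_ [x Ax <-]]; first by rewrite dg.
  by have [i _ Fx] := AF x Ax; exists i => //; exists x.
apply: eq_eseriesr => i _; rewrite /hausdorff_gauge dg.
have [->|/set0P[x Fx]] := eqVneq (F i) set0; first by rewrite image_set0 eqxx.
by rewrite ifN//; apply/set0P; exists (g x); exists x.
Qed.

(** Finite covers bound the Hausdorff premeasures; the definition asks for a
sequence of sets, so the finite family is continued by the empty set, whose
gauge is 0. *)
Lemma hausdorff_pre_fin_cover n k (I : finType) (F : I -> set 'rV[R]_n)
    (d e : R) (A : set 'rV[R]_n) : 0 <= d <= e ->
  (forall i x y, F i x -> F i y -> enorm (x - y) <= d) ->
  A `<=` \bigcup_i F i ->
  (hausdorff_pre k e A <= (#|I|%:R * d ^+ k)%:E)%E.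
Proof.
move=> /andP[d0 de] Fd AF.
pose G j := if insub j is Some i then F (@enum_val I predT i) else set0.
have gaugeG j : (hausdorff_gauge k (G j) <= (d ^+ k)%:E)%E.
  rewrite /hausdorff_gauge; case: ifPn => [_|/set0P[x Gx]].
    by rewrite lee_fin exprn_ge0.
  rewrite EFin_expe; apply: le_expe.
    by apply: ereal_sup_ubound; exists x => //; exists x => //; rewrite subrr enorm0.
  by move: Gx; rewrite /G; case: insubP => // i _ _ _; apply: ediam_le_real; exact: Fd.
apply: (@le_trans _ _ (\sum_(i <oo) hausdorff_gauge k (G i))%E).
  apply: ereal_inf_lbound; exists G => //; split => [j|x /AF[i _ Fx]].
    rewrite /G; case: insubP => [i _ _|_]; last exact: ediam_set0_le.
    by apply: ediam_le_real => x y Fx Fy; rewrite (le_trans _ de)// (Fd _ _ _ Fx Fy).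
  exists (enum_rank i) => //; rewrite /G.
  by rewrite valK enum_rankK.
rewrite (nneseries_split 0 #|I|) => [|j _]; last exact: hausdorff_gauge_ge0.
rewrite [X in (_ + X)%E](_ : _ = 0%E) ?adde0; last first.
  apply: eseries0 => j; rewrite add0n => Ij _.
  by rewrite /G insubF ?hausdorff_gauge0// ltnNge Ij.
rewrite add0n; apply: (@le_trans _ _ (\sum_(0 <= j < #|I|) (d ^+ k)%:E)%E).
  by apply: lee_sum => j _; exact: gaugeG.
by rewrite sumEFin lee_fin big_const_nat iter_addr_0 subn0 mulr_natl.
Qed.

End hausdorff_upper.

Section sphere_hausdorff_finite.
Context (R : realType) (m : nat).
Local Notation n := m.+1.
Variable N : nat.
Hypothesis N0 : (0 < N)%N.

(** The piece of the sphere where coordinate c.1.1 is bounded away from 0 with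
a given sign, and the other coordinates lie in a given cell of a grid of mesh
1/N. On such a piece the distinguished coordinate is a Lipschitz function of
the others. *)
Definition cap (c : 'I_n * bool * {ffun 'I_m -> 'I_(2 * N).+1}) : set 'rV[R]_n :=
  [set x | [/\ sphere R n x,
    n%:R^-1 <= (-1) ^+ c.1.2 * x ord0 c.1.1 &
    forall j, (c.2 j)%:R <= N%:R * (x ord0 (lift c.1.1 j) + 1) <= (c.2 j).+1%:R]].

Lemma sphere_coord_le1 k (x : 'rV[R]_k) (i : 'I_k) : sphere R k x -> `|x ord0 i| <= 1.
Proof.
move=> /sphere_dotp x1; rewrite -(@ler_pXn2r _ 2%N) ?nnegrE// expr1n real_normK ?num_real//.
rewrite -x1 /dotp (bigD1 i)//= -expr2 lerDl; apply: sumr_ge0 => j _.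
by rewrite -expr2 sqr_ge0.
Qed.

(** The coordinates of a unit vector have squares with sum 1, and each square
is at most the absolute value, so some absolute value is at least 1/n. *)
Lemma sphere_sub_caps : sphere R n `<=` \bigcup_c cap c.
Proof.
move=> x Sx; have N0' : (0 : R) < N%:R by rewrite ltr0n.
have n0 : (0 : R) < n%:R by rewrite ltr0n.
have [i xi] : exists i, n%:R^-1 <= `|x ord0 i|.
  apply: contrapT => /forallNP xlt.
  have : dotp x x < 1.
    apply: (@lt_le_trans _ _ (\sum_(i < n) n%:R^-1)).
      apply: ltr_sum => [|i _]; first by apply/hasP; exists ord0; rewrite ?mem_index_enum.
      have /negP := xlt i; rewrite -ltNge => xi.
      apply: le_lt_trans xi; rewrite -expr2 -real_normK ?num_real// expr2.
      by rewrite ler_piMr// sphere_coord_le1.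
    by rewrite big_const_ord iter_addr_0 -[leLHS]mulr_natl divff ?gt_eqF.
  by have /sphere_dotp -> := Sx; rewrite ltxx.
pose f := [ffun j : 'I_m => inord (Num.truncn (N%:R * (x ord0 (lift i j) + 1)))
   : 'I_(2 * N).+1].
exists (i, x ord0 i < 0, f) => //; split => //=.
  case: ltP => xi0; last by rewrite expr0 mul1r -(ger0_norm xi0).
  by rewrite expr1 mulN1r -(ltr0_norm xi0).
move=> j; rewrite ffunE; have := sphere_coord_le1 (lift i j) Sx.
set y := x ord0 _; rewrite ler_norml => /andP[y1 y2].
have z0 : 0 <= N%:R * (y + 1) by rewrite mulr_ge0// -lerBlDr sub0r.
rewrite inordK; first by have /andP[-> /ltW ->] := truncn_itv z0.
rewrite truncn_lt_nat//; apply: (@le_lt_trans _ _ (2 * N)%:R); last by rewrite ltr_nat.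
by rewrite natrM mulrC ler_pM2r//; lra.
Qed.

(** The distinguished coordinates u and v of two points of a cap satisfy
|u - v| (u + v) = |u^2 - v^2|, where u + v >= 2/n, and u^2 - v^2 is controlled
by the other coordinates because both points have norm 1. *)
Lemma cap_diam c x y : cap c x -> cap c y -> enorm (x - y) <= n%:R ^+ 3 / N%:R.
Proof.
have N0' : (0 : R) < N%:R by rewrite ltr0n.
have n0 : (0 : R) < n%:R by rewrite ltr0n.
have n1 : (1 : R) <= n%:R by rewrite ler1n.
move: c => [[i s] f] [Sx xi xf] [Sy yi yf] /=; rewrite /= in xi yi xf yf.
have nN0 : (0 : R) <= n%:R ^+ 2 / N%:R by rewrite divr_ge0 ?exprn_ge0.
rewrite exprS -mulrA; apply: enorm_le_coord => // l; rewrite !mxE.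
have off l' : l' != i -> `|x ord0 l' - y ord0 l'| <= N%:R^-1.
  rewrite eq_sym => /unlift_some[j -> _].
  rewrite -(ler_pM2l N0') divff ?gt_eqF// -[X in X * _](gtr0_norm N0') -normrM.
  move: (xf j) (yf j); rewrite -natr1 => /andP[? ?] /andP[? ?].
  by rewrite ler_norml; apply/andP; split; lra.
have [->|li] := eqVneq l i; last first.
  apply: le_trans (off l li) _; rewrite -[leLHS]mul1r ler_wpM2r ?invr_ge0 ?(ltW N0')//.
  by rewrite exprn_ege1.
pose u := (-1) ^+ s * x ord0 i; pose v := (-1) ^+ s * y ord0 i.
have -> : `|x ord0 i - y ord0 i| = `|u - v| by rewrite /u /v -mulrBr normrM normr_sign mul1r.
have uE : u ^+ 2 = 1 - \sum_(j | j != i) x ord0 j * x ord0 j.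
  have /sphere_dotp := Sx; rewrite /dotp (bigD1 i)//= => <-.
  by rewrite addrK /u exprMn sqrr_sign mul1r expr2.
have vE : v ^+ 2 = 1 - \sum_(j | j != i) y ord0 j * y ord0 j.
  have /sphere_dotp := Sy; rewrite /dotp (bigD1 i)//= => <-.
  by rewrite addrK /v exprMn sqrr_sign mul1r expr2.
have uv : 2 / n%:R <= u + v by rewrite mulrDl mul1r lerD.
have uv0 : 0 < u + v by rewrite (lt_le_trans _ uv)// divr_gt0.
have uvE : `|u - v| * (u + v) <= n%:R * (2 / N%:R).
  rewrite -[X in _ * X](gtr0_norm uv0) -normrM -subr_sqr uE vE.
  have -> (a b : R) : 1 - a - (1 - b) = b - a by ring.
  rewrite -sumrB (le_trans (ler_norm_sum _ _ _))//.
  apply: (@le_trans _ _ (\sum_(j < n) 2 / N%:R)); last first.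
    by rewrite big_const_ord iter_addr_0 -[leLHS]mulr_natl.
  rewrite [leLHS]big_mkcond; apply: ler_sum => j _; case: ifPn => [ji|_]; last first.
    by rewrite divr_ge0 ?(ltW N0').
  have -> : y ord0 j * y ord0 j - x ord0 j * x ord0 j =
    (y ord0 j + x ord0 j) * (y ord0 j - x ord0 j) by ring.
  rewrite normrM ler_pM//; last by rewrite distrC off.
  by rewrite (le_trans (ler_normD _ _))// -[2]/(1 + 1) lerD// sphere_coord_le1.
have : `|u - v| * (2 / n%:R) <= n%:R * (2 / N%:R).
  by apply: le_trans uvE; rewrite ler_wpM2l.
rewrite [X in X <= _]mulrA ler_pdivrMr// => h.
rewrite -(ler_pM2r (x := 2)) // (le_trans h)// le_eqVlt; apply/orP; left; apply/eqP; ring.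
Qed.

End sphere_hausdorff_finite.

(** There are O(N^(n-1)) caps, of diameter O(1/N). *)
Lemma hausdorff_sphere_lty (R : realType) m :
  (hausdorff m (sphere R m.+1) < +oo)%E.
Proof.
pose n := m.+1.
apply: (@le_lt_trans _ _ (n%:R * 2 * (3 * n%:R ^+ 3) ^+ m)%:E); last exact: ltry.
apply: ge_ereal_sup => _ [e e0 <-].
pose N := (Num.truncn (n%:R ^+ 3 / e : R)).+1.
have N0' : (0 : R) < N%:R by rewrite ltr0n.
have Ne : n%:R ^+ 3 / N%:R <= e.
  rewrite ler_pdivrMr// mulrC -ler_pdivrMr//.
  by have /andP[_ /ltW] := truncn_itv (divr_ge0 (exprn_ge0 3 (ler0n R n)) (ltW e0)).
have dN : (0 : R) <= n%:R ^+ 3 / N%:R <= e by apply/andP; split; rewrite // divr_ge0// exprn_ge0.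
apply: le_trans (hausdorff_pre_fin_cover m dN (@cap_diam R m N isT)
  (@sphere_sub_caps R m N isT)) _.
rewrite lee_fin !card_prod card_ffun !card_ord card_bool -/n !natrM -mulrA.
rewrite ler_wpM2l ?mulr_ge0// natrX -exprMn lerXn2r ?nnegrE ?mulr_ge0 ?exprn_ge0 ?divr_ge0//.
rewrite mulrCA [leRHS]mulrC ler_wpM2l ?exprn_ge0// ler_pdivrMr//.
by rewrite -natrM ler_nat; lia.
Qed.

(** * Hausdorff measure: positivity on the sphere *)

Lemma card_close_ord (R : realType) (N : nat) (h r z : R) : 0 < h -> 0 < r ->
  #|[set i : 'I_N | `|z - i%:R * h| < r]%SET|%:R <= 2 * r / h + 1.
Proof.
move=> h0 r0; set A := finset _.
have K0 : 0 <= 2 * r / h by rewrite divr_ge0 ?mulr_ge0 ?(ltW r0) ?(ltW h0).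
have [->|[i0 Ai0]] := set_0Vmem A; first by rewrite cards0 addr_ge0.
pose a := [arg min_(i < i0 in A) (i : nat)].
have [Aa amin] : a \in A /\ (forall j, j \in A -> (a <= j)%N).
  by rewrite /a; case: arg_minnP => // j Aj jmin.
pose K := Num.truncn (2 * r / h).
have AK i : i \in A -> (a <= i < a + K.+1)%N.
  move=> Ai; rewrite amin//= addnS ltnS -leq_subLR truncn_ge_nat//.
  rewrite natrB ?amin// ler_pdivlMr//.
  move: Aa Ai; rewrite !inE !ltr_norml => /andP[? ?] /andP[? ?].
  by rewrite mulrBl; lra.
have : (#|A| <= K.+1)%N.
  rewrite cardE -(size_map val) -(size_iota a K.+1).
  apply: uniq_leq_size; first by rewrite map_inj_uniq ?enum_uniq//; exact: val_inj.
  by move=> _ /mapP[i + ->]; rewrite mem_enum mem_iota => /AK.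
rewrite -(ler_nat R) => /le_trans; apply.
by rewrite -natr1 lerD2r truncn_le.
Qed.

Section sphere_hausdorff_pos.
Context (R : realType) (m : nat).
Hypothesis m0 : (0 < m)%N.
Local Notation n := m.+1.

(** The sphere contains the graph of a function over a small cube of R^m. Points
of a grid of that cube, lifted to the sphere, serve to bound covers from
below. *)
Definition lift_point (y : 'I_m -> R) : 'rV[R]_n :=
  \row_i if unlift ord0 i is Some j then y j else Num.sqrt (1 - \sum_j y j ^+ 2).

Lemma lift_point_sphere (y : 'I_m -> R) :
  (forall j, 0 <= y j <= m%:R^-1) -> sphere R n (lift_point y).
Proof.
move=> yb; apply/sphere_dotp; rewrite /dotp /lift_point big_ord_recl !mxE unlift_none.
rewrite [X in _ + X](eq_bigr (fun j => y j ^+ 2)) => [|j _]; last first.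
  by rewrite !mxE liftK expr2.
have m0' : (0 : R) < m%:R by rewrite ltr0n.
rewrite -expr2 sqr_sqrtr ?subrK// subr_ge0.
apply: (@le_trans _ _ (\sum_(j < m) m%:R^-1)).
  apply: ler_sum => j _; have /andP[y0 y1] := yb j.
  apply: le_trans y1; rewrite expr2 ler_piMr//; apply: (le_trans (andP (yb j)).2).
  by rewrite invf_le1// ler1n.
by rewrite big_const_ord iter_addr_0 -[leLHS]mulr_natl divff ?gt_eqF.
Qed.

(** A counting argument: of the N^m lifted grid points, a ball of radius r
contains at most ((2m + 1) r N)^m as soon as r >= 1/N, so finitely many balls
that cover the sphere have radii with sum of m-th powers bounded below. *)
Lemma ball_cover_sum (s : seq nat) (z : nat -> 'rV[R]_n) (r : nat -> R) :
  (forall i, 0 < r i) ->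
  (forall x, sphere R n x -> exists2 i, i \in s & ball (z i) (r i) x) ->
  (2 * m + 1)%:R ^- m <= \sum_(i <- s) r i ^+ m.
Proof.
move=> r0 scov; have m0' : (0 : R) < m%:R by rewrite ltr0n.
have [d d0 dr] : exists2 d, 0 < d & forall i, i \in s -> d <= r i.
  elim: s {scov} => [|i s [d d0 dr]]; first by exists 1.
  exists (Num.min d (r i)); first by rewrite lt_min d0 r0.
  move=> j; rewrite inE ge_min => /predU1P[->|/dr ->//].
  by rewrite lexx orbT.
pose N := (Num.truncn d^-1).+1.
have N0 : (0 : R) < N%:R by rewrite ltr0n.
have Nd : N%:R^-1 <= d.
  have /andP[_ /ltW dN] := truncn_itv (ltW (etrans (invr_gt0 d) d0)).
  by rewrite -(invrK d) lef_pV2// posrE invr_gt0.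
pose h : R := (m%:R * N%:R)^-1.
have h0 : 0 < h by rewrite invr_gt0 mulr_gt0.
pose pt (f : {ffun 'I_m -> 'I_N}) := lift_point (fun j => (f j)%:R * h).
have ptS f : sphere R n (pt f).
  apply: lift_point_sphere => j; rewrite mulr_ge0 ?(ltW h0)//=.
  rewrite /h invfM mulrCA ler_piMr ?invr_ge0 ?(ltW m0')//.
  by rewrite ler_pdivrMr// mul1r ler_nat ltnW.
pose B i := [set f | `[< ball (z i) (r i) (pt f) >]]%SET.
have cardB i : i \in s -> #|B i|%:R <= ((2 * m + 1)%:R * r i * N%:R) ^+ m.
  move=> si.
  pose F j : {set 'I_N} := [set k : 'I_N | `|z i ord0 (lift ord0 j) - k%:R * h| < r i]%SET.
  have : (#|B i| <= #|family (fun j => mem (F j))|)%N.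
    apply: subset_leq_card; apply/fintype.subsetP => f; rewrite inE => /asboolP bf.
    apply/familyP => j; rewrite inE.
    by have := bf.2 ord0 (lift ord0 j); rewrite /ball /= /pt /lift_point mxE liftK.
  rewrite -(ler_nat R) => /le_trans; apply.
  rewrite card_family.
  have gen (C : R) (ks : seq nat) : (forall k, k \in ks -> k%:R <= C) ->
      (foldr muln 1%N ks)%:R <= C ^+ size ks.
    elim: ks => //= k ks ih kle; rewrite natrM exprS ler_pM// ?kle ?mem_head//.
    by rewrite ih// => k' k's; rewrite kle// inE k's orbT.
  apply: le_trans (gen ((2 * m + 1)%:R * r i * N%:R) _ _) _; last first.
    by rewrite size_map -cardE card_ord.
  move=> k /mapP[j _ ->]; apply: le_trans (card_close_ord _ _ h0 (r0 i)) _.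
  rewrite /h invrK natrD natrM.
  have : 1 <= r i * N%:R.
    by rewrite -ler_pdivrMr// div1r (le_trans Nd)// dr.
  set rN := r i * _ => rN1; rewrite -[leRHS]mulrA -/rN.
  have -> : 2 * r i * (m%:R * N%:R) = 2 * m%:R * rN by rewrite /rN; ring.
  by rewrite [leRHS]mulrDl mul1r lerD2l.
have : (#|{ffun 'I_m -> 'I_N}| <= \sum_(i <- s) #|B i|)%N.
  rewrite -sum1_card.
  under [X in (_ <= X)%N]eq_bigr do rewrite -sum1_card big_mkcond /=.
  rewrite exchange_big /=; apply: leq_sum => f _.
  have [i si bi] := scov _ (ptS f).
  by rewrite (big_rem i)//= inE; case: asboolP.
rewrite card_ffun !card_ord -(ler_nat R) natr_sum natrX => NB.
have : N%:R ^+ m <= (2 * m + 1)%:R ^+ m * N%:R ^+ m * \sum_(i <- s) r i ^+ m.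
  rewrite mulr_sumr (le_trans NB)// big_seq [leRHS]big_seq.
  by apply: ler_sum => i /cardB; rewrite !exprMn mulrAC.
have Nm : (0 : R) < N%:R ^+ m by rewrite exprn_gt0.
rewrite mulrAC -[leLHS]mul1r ler_pM2r// -[_ * \sum_(_ <- _) _]mulrC.
by rewrite -ler_pdivrMr ?div1r// exprn_gt0// ltr0n addn1.
Qed.

Lemma compact_sphere : compact (sphere R n).
Proof.
apply: bounded_closed_compact.
  exists 1; split => // M M1 x Sx; apply: le_trans (ltW M1).
  by rewrite (le_trans (ler_norm_enorm x))// Sx.
have -> : sphere R n = @enorm R n @^-1` [set 1] by [].
by apply: preimage_closed; [move=> ? _; exact: continuous_enorm|exact: closed_eq].
Qed.

(** Each set of a countable cover is enlarged to an open ball of comparable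
radius, up to a summable error that takes care of the sets of diameter 0; by
compactness finitely many balls suffice. *)
Lemma hausdorff_sphere_gt0 : (0 < hausdorff m (sphere R n))%E.
Proof.
pose c : R := (2 * m + 1)%:R ^- m.
have c0 : 0 < c by rewrite /c invr_gt0 exprn_gt0// ltr0n addn1.
apply: (@lt_le_trans _ _ (hausdorff_pre m 1 (sphere R n))); last first.
  by apply: ereal_sup_ubound; exists 1 => //=.
apply: (@lt_le_trans _ _ (c / 2 / 2 ^+ m)%:E).
  by rewrite lte_fin !divr_gt0// exprn_gt0.
apply: le_ereal_inf_tmp => _ [F [dF SF] <-].
pose e : R := Num.min 1 (c / 2).
have e0 : 0 < e by rewrite lt_min ltr01 divr_gt0.
pose d i := fine (ediam (F i)).
pose rho i : R := e / (2 ^ i.+1)%:R.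
have rho0 i : 0 < rho i by rewrite divr_gt0// ltr0n expn_gt0.
have rho1 i : rho i <= 1.
  rewrite ler_pdivrMr ?ltr0n ?expn_gt0// mul1r (@le_trans _ _ 1)//.
    by rewrite /e ge_min lexx.
  by rewrite ler1n expn_gt0.
pose ne i := F i != set0.
have dE i : ne i -> 0 <= d i /\ hausdorff_gauge m (F i) = (d i ^+ m)%:E.
  move=> /[dup] Fi /set0P[x Fx].
  have d_ge0 : (0 <= ediam (F i))%E.
    by apply: ereal_sup_ubound; exists x => //; exists x => //; rewrite subrr enorm0.
  have dfin : ediam (F i) \is a fin_num.
    by rewrite ge0_fin_numE// (le_lt_trans (dF i)) ?ltry.
  split; first exact: fine_ge0.
  by rewrite /hausdorff_gauge (negbTE Fi) EFin_expe fineK.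
(* a ball of radius 2 * d i contains F i when d i > 0; rho i covers d i = 0 *)
pose r i := if ne i then Num.max (2 * d i) (rho i) else rho i.
have r0 i : 0 < r i by rewrite /r; case: ifP => _; rewrite ?lt_max rho0 ?orbT.
have rd i : ne i -> d i < r i.
  move=> /[dup] ni /dE[di _]; rewrite /r ni lt_max.
  have [->|d0] := eqVneq (d i) 0; first by rewrite rho0 orbT.
  by rewrite ltr_pMl ?ltr1n// lt0r d0.
have rm i : ((r i ^+ m)%:E <= (2 ^+ m)%:E * hausdorff_gauge m (F i) + (rho i)%:E)%E.
  have rhom : rho i ^+ m <= rho i.
    by rewrite -[leRHS]expr1; apply: ler_wiXn2l => //; exact: ltW.
  rewrite /r; case: ifPn => [/dE[di ->]|ni].
    rewrite -EFinM -EFinD lee_fin maxEle -exprMn; case: ifP => _.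
      by rewrite (le_trans rhom)// lerDr exprn_ge0// mulr_ge0.
    by rewrite lerDl ltW.
  apply: (@le_trans _ _ (rho i)%:E); first by rewrite lee_fin.
  by rewrite leeDr// mule_ge0 ?lee_fin ?exprn_ge0// hausdorff_gauge_ge0.
pose z i := get (F i).
have FB i : F i `<=` ball (z i) (r i).
  move=> x Fx; have ni : ne i by apply/set0P; exists x.
  have Fz : F i (z i) by apply: getI Fx.
  rewrite -ball_normE /=; apply: le_lt_trans (rd i ni).
  apply: le_trans (ler_norm_enorm _) _; rewrite -lee_fin fineK.
    by apply: ereal_sup_ubound; exists (z i) => //; exists x.
  rewrite ge0_fin_numE ?(le_lt_trans (dF i)) ?ltry//.
  by apply: ereal_sup_ubound; exists x => //; exists x => //; rewrite subrr enorm0.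
have [D _ SD] : finite_subset_cover [set: nat] (fun i => ball (z i) (r i)) (sphere R n).
  have := compact_sphere; rewrite compact_cover; apply.
    by move=> i _; apply: ball_open.
  by move=> x /SF[i _ /FB]; exists i.
have cr : c <= \sum_(i <- finmap.enum_fset D) r i ^+ m.
  by apply: (ball_cover_sum (z := z)) => // x /SD[i /= Di bi]; exists i.
set S := (\sum_(i <oo) _)%E.
have gauge0 i : (0 <= (2 ^+ m)%:E * hausdorff_gauge m (F i))%E.
  by rewrite mule_ge0 ?lee_fin ?exprn_ge0// hausdorff_gauge_ge0.
have cS : (c%:E <= (2 ^+ m)%:E * S + e%:E)%E.
  rewrite /S -nneseriesZl; last by move=> i _; exact: hausdorff_gauge_ge0.
  apply: (le_trans _ (epsilon_trick xpredT gauge0 (ltW e0))).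
  apply: (le_trans _ (@lee_sum_fset_lim R _ D xpredT _)); last first.
    by move=> i _; rewrite adde_ge0// lee_fin ltW// rho0.
  apply: (@le_trans _ _ (\sum_(i <- finmap.enum_fset D) r i ^+ m)%:E).
    by rewrite lee_fin.
  by rewrite -sumEFin; apply: lee_sum => i _; exact: rm.
have ec : e <= c / 2 by rewrite /e ge_min lexx orbT.
have S0 : (0 <= S)%E by apply: nneseries_ge0 => i _ _; exact: hausdorff_gauge_ge0.
move: S0 cS; case: S => [S| |] //; last by move=> _ _; rewrite leey.
rewrite !lee_fin => S0 cS; rewrite ler_pdivrMr ?exprn_gt0// mulrC.
by lra.
Qed.

End sphere_hausdorff_pos.

(** * Integrals of bounded measurable functions *)

Section bounded_measurable.
Context d (T : measurableType d) (R : realType) (D : set T).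
Hypothesis mD : measurable D.
Implicit Types (f g : T -> R) (mu : probability T R).

(** All the integrands of interest are of this form; they are integrable for
every probability measure, so that linearity needs no further hypothesis. *)
Definition bounded_measurable f :=
  measurable_fun D f /\ exists M, forall x, D x -> `|f x| <= M.

Lemma bm_cst (c : R) : bounded_measurable (cst c).
Proof. by split; [exact: measurable_cst|exists `|c|]. Qed.

Lemma bmD f g : bounded_measurable f -> bounded_measurable g ->
  bounded_measurable (fun x => f x + g x).
Proof.
move=> [mf [M fM]] [mg [N gN]]; split; first exact: measurable_funD.
by exists (M + N) => x Dx; rewrite (le_trans (ler_normD _ _))// lerD ?fM ?gN.
Qed.

Lemma bmM f g : bounded_measurable f -> bounded_measurable g ->
  bounded_measurable (fun x => f x * g x).
Proof.
move=> [mf [M fM]] [mg [N gN]]; split; first exact: measurable_funM.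
by exists (M * N) => x Dx; rewrite normrM ler_pM ?fM ?gN.
Qed.

Lemma bm_sum I (s : seq I) (F : I -> T -> R) :
  (forall i, bounded_measurable (F i)) ->
  bounded_measurable (fun x => \sum_(i <- s) F i x).
Proof.
move=> bF; elim: s => [|i s ih].
  by under eq_fun do rewrite big_nil; exact: bm_cst.
under eq_fun do rewrite big_cons.
exact: bmD.
Qed.

Lemma bm_prod I (s : seq I) (F : I -> T -> R) :
  (forall i, bounded_measurable (F i)) ->
  bounded_measurable (fun x => \prod_(i <- s) F i x).
Proof.
move=> bF; elim: s => [|i s ih].
  by under eq_fun do rewrite big_nil; exact: bm_cst.
under eq_fun do rewrite big_cons.
exact: bmM.
Qed.

Lemma bmX f k : bounded_measurable f -> bounded_measurable (fun x => f x ^+ k).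
Proof.
move=> bf; elim: k => [|k ih]; first exact: bm_cst.
under eq_fun do rewrite exprS.
exact: bmM.
Qed.

Lemma bm_integrable mu f : bounded_measurable f -> mu.-integrable D (EFin \o f).
Proof.
move=> [mf [M fM]]; apply: measurable_bounded_integrable => //.
  by rewrite (le_lt_trans (probability_le1 _ _))// ltry.
by exists M; split; rewrite ?num_real// => N MN x Dx; rewrite /= (le_trans (fM x Dx))// ltW.
Qed.

Lemma bm_integralE mu f : bounded_measurable f ->
  (\int[mu]_(x in D) (f x)%:E)%E = (\int[mu]_(x in D) f x)%:E.
Proof.
move=> bf; rewrite /Rintegral fineK//; apply: integrable_fin_num => //.
exact: bm_integrable.
Qed.

Lemma RintegralZl_bm mu c f : bounded_measurable f ->
  \int[mu]_(x in D) (c * f x) = c * \int[mu]_(x in D) f x.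
Proof. by move=> bf; apply: RintegralZl => //; exact: bm_integrable. Qed.

Lemma RintegralZr_bm mu c f : bounded_measurable f ->
  \int[mu]_(x in D) (f x * c) = (\int[mu]_(x in D) f x) * c.
Proof. by move=> bf; apply: RintegralZr => //; exact: bm_integrable. Qed.

Lemma RintegralD_bm mu f g : bounded_measurable f -> bounded_measurable g ->
  \int[mu]_(x in D) (f x + g x) = \int[mu]_(x in D) f x + \int[mu]_(x in D) g x.
Proof. by move=> bf bg; apply: RintegralD => //; exact: bm_integrable. Qed.

Lemma Rintegral_sum_bm mu I (s : seq I) (F : I -> T -> R) :
  (forall i, bounded_measurable (F i)) ->
  \int[mu]_(x in D) (\sum_(i <- s) F i x) = \sum_(i <- s) \int[mu]_(x in D) F i x.
Proof.
move=> bF; elim: s => [|i s ih].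
  rewrite big_nil; under eq_Rintegral do rewrite big_nil.
  by rewrite Rintegral_cst// mul0r.
under eq_Rintegral do rewrite big_cons.
by rewrite RintegralD_bm ?ih ?big_cons//; exact: bm_sum.
Qed.

Lemma le_Rintegral_bm mu f g : bounded_measurable f -> bounded_measurable g ->
  (forall x, D x -> f x <= g x) ->
  \int[mu]_(x in D) f x <= \int[mu]_(x in D) g x.
Proof. by move=> bf bg; apply: le_Rintegral => //; exact: bm_integrable. Qed.

Lemma Rintegral_cst1 mu (c : R) : mu D = 1%E -> \int[mu]_(x in D) c = c.
Proof.
move=> muD; rewrite Rintegral_cst// -[RHS]mulr1; congr (_ * _).
exact: (congr1 fine muD).
Qed.

Lemma eq_Rintegral_in mu f g : (forall x, D x -> f x = g x) ->
  \int[mu]_(x in D) f x = \int[mu]_(x in D) g x.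
Proof. by move=> fg; apply: eq_Rintegral => x /set_mem /fg. Qed.

Lemma Rintegral_dist_le mu f g (e : R) : mu D = 1%E ->
  bounded_measurable f -> bounded_measurable g ->
  (forall x, D x -> `|f x - g x| <= e) ->
  `|\int[mu]_(x in D) f x - \int[mu]_(x in D) g x| <= e.
Proof.
move=> muD bf bg fg; rewrite ler_distlC.
have bE := bm_cst e; have bNE := bm_cst (- e).
rewrite -{1 2}(Rintegral_cst1 e muD); apply/andP; split.
  rewrite lerBlDr -RintegralD_bm//; apply: le_Rintegral_bm => //; first exact: bmD.
  by move=> x /fg; rewrite ler_distlC => /andP[]; rewrite lerBlDr.
rewrite -RintegralD_bm//; apply: le_Rintegral_bm => //; first exact: bmD.
by move=> x /fg; rewrite ler_distlC => /andP[].
Qed.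

Lemma Rintegral_eq0_ae mu f : bounded_measurable f ->
  (forall x, D x -> 0 <= f x) -> \int[mu]_(x in D) f x = 0 ->
  {ae mu, forall x, D x -> f x = 0}.
Proof.
move=> bf f0 If; have mf : measurable_fun D (EFin \o f).
  by apply/measurable_EFinP; exact: bf.1.
have /(ae_eq_integral_abs mu mD mf) : (\int[mu]_(x in D) `|(f x)%:E|)%E = 0%E.
  rewrite -[RHS](_ : (\int[mu]_(x in D) (f x)%:E)%E = _); last first.
    by rewrite bm_integralE// If.
  by apply: eq_integral => x /set_mem Dx; rewrite /= ger0_norm ?f0.
by move=> [N [mN N0 DN]]; exists N; split => // x /= xP; apply: DN => /= Dx; apply: xP => /Dx [].
Qed.

Lemma ae_exists mu (P : T -> Prop) : mu D = 1%E ->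
  {ae mu, forall x, D x -> P x} -> exists2 x, D x & P x.
Proof.
move=> muD [N [mN N0 DN]]; apply: contrapT => nP.
have DsubN : D `<=` N.
  by move=> x Dx; apply: DN => /= xP; apply: nP; exists x => //; exact: xP.
have : (mu D <= mu N)%E by apply: le_measure; rewrite ?inE.
by rewrite muD N0 lee_fin ler10.
Qed.

Lemma Rintegral_eq0_exists mu f : mu D = 1%E -> bounded_measurable f ->
  (forall x, D x -> 0 <= f x) -> \int[mu]_(x in D) f x = 0 ->
  exists2 x, D x & f x = 0.
Proof. by move=> muD bf f0 If; apply: (ae_exists muD); exact: (Rintegral_eq0_ae bf f0 If). Qed.

End bounded_measurable.

(** * Moments and energies of kernels of an inner product *)

Section moments.
Context d (T : measurableType d) (R : realType) (D : set T).
Hypothesis mD : measurable D.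
Variables (n : nat) (X : 'I_n -> T -> R).
Hypothesis mX : forall i, measurable_fun setT (X i).
Hypothesis X1 : forall v, D v -> \sum_(i < n) X i v ^+ 2 = 1.
Implicit Types (mu nu : probability T R) (v w : T).

(** The vectors (X i v) are thought of as unit vectors; gram is the matrix of
their inner products. *)
Definition gram v w := \sum_(i < n) X i v * X i w.

Definition monom k (f : {ffun 'I_k -> 'I_n}) v := \prod_j X (f j) v.

Definition moment mu k (f : {ffun 'I_k -> 'I_n}) : R :=
  \int[mu]_(v in D) monom f v.

(** The power of an inner product is the inner product of tensor powers; f
ranges over the words of length k, which index the coordinates of the k-th
tensor power. *)
Lemma gramX k v w :
  gram v w ^+ k = \sum_(f : {ffun 'I_k -> 'I_n}) monom f v * monom f w.
Proof.
rewrite -[LHS](_ : \prod_(j < k) gram v w = _); last by rewrite prodr_const card_ord.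
by rewrite bigA_distr_bigA; apply: eq_bigr => f _; rewrite big_split.
Qed.

Lemma gram_norm_le v w : D v -> D w -> `|gram v w| <= 1.
Proof.
move=> Dv Dw; rewrite ler_norml.
have hp : 0 <= \sum_(i < n) (X i v + X i w) ^+ 2 by apply: sumr_ge0 => i _; exact: sqr_ge0.
have hm : 0 <= \sum_(i < n) (X i v - X i w) ^+ 2 by apply: sumr_ge0 => i _; exact: sqr_ge0.
have sE (c : R) : \sum_(i < n) (X i v + c * X i w) ^+ 2 = 1 + c ^+ 2 + 2 * c * gram v w.
  transitivity (\sum_(i < n) X i v ^+ 2 + c ^+ 2 * (\sum_(i < n) X i w ^+ 2) + 2 * c * gram v w).
    rewrite /gram !mulr_sumr -!big_split /=.
    by apply: eq_bigr => i _; ring.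
  by rewrite !X1// mulr1.
move: hp hm; rewrite -[X in 0 <= X -> _](_ : \sum_(i < n) (X i v + 1 * X i w) ^+ 2 = _); last first.
  by apply: eq_bigr => i _; rewrite mul1r.
rewrite -[X in _ -> 0 <= X -> _](_ : \sum_(i < n) (X i v + -1 * X i w) ^+ 2 = _); last first.
  by apply: eq_bigr => i _; rewrite mulN1r.
by rewrite !sE => h1 h2; apply/andP; split; lra.
Qed.

Lemma coord_bm i : bounded_measurable D (X i).
Proof.
split; first exact: measurable_funTS.
exists 1 => v Dv; rewrite -(@ler_pXn2r _ 2%N) ?nnegrE// expr1n real_normK ?num_real//.
by rewrite -(X1 Dv) (bigD1 i)//= lerDl; apply: sumr_ge0 => j _; exact: sqr_ge0.
Qed.

Lemma monom_bm k (f : {ffun 'I_k -> 'I_n}) : bounded_measurable D (monom f).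
Proof. by apply: bm_prod => j; exact: coord_bm. Qed.

Lemma gram_bm w : bounded_measurable D (gram ^~ w).
Proof. by apply: bm_sum => i; apply: bmM; [exact: coord_bm|exact: bm_cst]. Qed.

Lemma Rintegral_gramX mu k w :
  \int[mu]_(v in D) gram v w ^+ k =
  \sum_(f : {ffun 'I_k -> 'I_n}) moment mu f * monom f w.
Proof.
under eq_Rintegral do rewrite gramX.
rewrite Rintegral_sum_bm// => [|f]; last by apply: bmM; [exact: monom_bm|exact: bm_cst].
by apply: eq_bigr => f _; rewrite RintegralZr_bm//; exact: monom_bm.
Qed.

Lemma Rintegral_gramX_bm mu k :
  bounded_measurable D (fun w => \int[mu]_(v in D) gram v w ^+ k).
Proof.
under eq_fun do rewrite Rintegral_gramX.
by apply: bm_sum => f; apply: bmM; [exact: bm_cst|exact: monom_bm].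
Qed.

(** The mutual energy of two measures for the kernel t^k is the inner product
of their vectors of moments; this is why t^k is a positive definite kernel. *)
Lemma Rintegral2_gramX mu nu k :
  \int[nu]_(w in D) (\int[mu]_(v in D) gram v w ^+ k) =
  \sum_(f : {ffun 'I_k -> 'I_n}) moment mu f * moment nu f.
Proof.
under eq_Rintegral do rewrite Rintegral_gramX.
rewrite Rintegral_sum_bm// => [|f]; last by apply: bmM; [exact: bm_cst|exact: monom_bm].
by apply: eq_bigr => f _; rewrite RintegralZl_bm//; exact: monom_bm.
Qed.

Lemma Rintegral_horner_gram mu (Q : {poly R}) w :
  \int[mu]_(v in D) Q.[gram v w] =
  \sum_(k < size Q) Q`_k * \int[mu]_(v in D) gram v w ^+ k.
Proof.
have bX k : bounded_measurable D (fun v => gram v w ^+ k).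
  by apply: bmX; exact: gram_bm.
under eq_Rintegral do rewrite horner_coef.
rewrite Rintegral_sum_bm// => [|k]; last by apply: bmM; [exact: bm_cst|exact: bX].
by apply: eq_bigr => k _; rewrite RintegralZl_bm.
Qed.

Lemma horner_gram_bm (Q : {poly R}) w : bounded_measurable D (fun v => Q.[gram v w]).
Proof.
under eq_fun do rewrite horner_coef.
apply: bm_sum => k; apply: bmM; first exact: bm_cst.
by apply: bmX; exact: gram_bm.
Qed.

Lemma Rintegral_horner_gram_bm mu (Q : {poly R}) :
  bounded_measurable D (fun w => \int[mu]_(v in D) Q.[gram v w]).
Proof.
under eq_fun do rewrite Rintegral_horner_gram.
by apply: bm_sum => k; apply: bmM; [exact: bm_cst|exact: Rintegral_gramX_bm].
Qed.

Lemma Rintegral2_horner_gram mu nu (Q : {poly R}) :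
  \int[nu]_(w in D) (\int[mu]_(v in D) Q.[gram v w]) =
  \sum_(k < size Q) Q`_k * \int[nu]_(w in D) (\int[mu]_(v in D) gram v w ^+ k).
Proof.
under eq_Rintegral do rewrite Rintegral_horner_gram.
rewrite Rintegral_sum_bm// => [|k]; last first.
  by apply: bmM; [exact: bm_cst|exact: Rintegral_gramX_bm].
by apply: eq_bigr => k _; rewrite RintegralZl_bm//; exact: Rintegral_gramX_bm.
Qed.

(** What rotation invariance is used for: the potential of the measure is
constant on D, for every kernel that is a power of the inner product. *)
Definition equipotential mu := mu D = 1%E /\ forall k w w', D w -> D w' ->
  \int[mu]_(v in D) gram v w ^+ k = \int[mu]_(v in D) gram v w' ^+ k.

(** Expand the sum of the squares of the differences of the moments of mu and
sigma: the mutual energy of mu and sigma equals the energy of sigma, because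
the potential of sigma is constant. *)
Lemma gramX_energy_min mu sigma k : mu D = 1%E -> equipotential sigma ->
  \int[sigma]_(w in D) (\int[sigma]_(v in D) gram v w ^+ k) <=
  \int[mu]_(w in D) (\int[mu]_(v in D) gram v w ^+ k).
Proof.
move=> muD [sD sE].
have [w0 Dw0] : exists w, D w.
  apply: contrapT => /forallNP D0; have : D = set0 by apply/seteqP; split => // x /D0.
  by move=> D00; move: muD; rewrite D00 measure0 => /eqP; rewrite eq_sym onee_eq0.
pose c := \int[sigma]_(v in D) gram v w0 ^+ k.
have cE nu : nu D = 1%E -> \int[nu]_(w in D) (\int[sigma]_(v in D) gram v w ^+ k) = c.
  move=> nuD; rewrite -[RHS](Rintegral_cst1 mD c nuD).
  by apply: eq_Rintegral_in => w Dw; exact: sE.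
have h : 0 <= \sum_(f : {ffun 'I_k -> 'I_n}) (moment mu f - moment sigma f) ^+ 2.
  by apply: sumr_ge0 => f _; exact: sqr_ge0.
have : \sum_(f : {ffun 'I_k -> 'I_n}) (moment mu f - moment sigma f) ^+ 2 =
  \int[mu]_(w in D) (\int[mu]_(v in D) gram v w ^+ k) - 2 *
  \int[mu]_(w in D) (\int[sigma]_(v in D) gram v w ^+ k) +
  \int[sigma]_(w in D) (\int[sigma]_(v in D) gram v w ^+ k).
  rewrite !Rintegral2_gramX mulr_sumr -sumrN -!big_split /=.
  by apply: eq_bigr => f _; ring.
by rewrite !cE// => hE; rewrite hE in h; lra.
Qed.

(** The terms of degree 0 agree, because both measures have mass 1; in the other
degrees the sign of the coefficient reverses the inequality for t^k. *)
Lemma horner_energy_max mu sigma (Q : {poly R}) : mu D = 1%E -> equipotential sigma ->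
  (forall k, (0 < k)%N -> Q`_k <= 0) ->
  \int[mu]_(w in D) (\int[mu]_(v in D) Q.[gram v w]) <=
  \int[sigma]_(w in D) (\int[sigma]_(v in D) Q.[gram v w]).
Proof.
move=> muD es Q0; rewrite !Rintegral2_horner_gram; apply: ler_sum => -[[|k] k1] _ /=.
  have e0 nu : nu D = 1%E -> \int[nu]_(w in D) (\int[nu]_(v in D) gram v w ^+ 0) = 1.
    move=> nuD; rewrite -[RHS](Rintegral_cst1 mD 1 nuD); apply: eq_Rintegral => w _.
    by rewrite -[RHS](Rintegral_cst1 mD 1 nuD); apply: eq_Rintegral => v _; rewrite expr0.
  by rewrite !e0//; case: es.
by apply: ler_wnM2l; [exact: Q0|exact: gramX_energy_min].
Qed.

Section kernel.
Variable phi : R -> R.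
Hypothesis mphi : measurable_fun setT phi.
Hypothesis phi_ge0 : forall t, 0 <= phi t.
Variable M : R.
Hypothesis phi_le : forall t, `|t| <= 1 -> phi t <= M.

Lemma kernel_bm w : D w -> bounded_measurable D (fun v => phi (gram v w)).
Proof.
move=> Dw; split.
  apply: measurableT_comp => //; exact: (gram_bm w).1.
by exists M => v Dv; rewrite ger0_norm// phi_le// gram_norm_le.
Qed.

(** Tonelli, applied to the kernel cut off outside D. *)
Lemma Rintegral_kernel_bm mu :
  bounded_measurable D (fun w => \int[mu]_(v in D) phi (gram v w)).
Proof.
split; last first.
  exists `|M| => w Dw; rewrite ger0_norm ?Rintegral_ge0//.
  have MD : \int[mu]_(v in D) `|M| <= `|M|.
    rewrite Rintegral_cst// ler_piMr// -lee_fin fineK ?probability_le1//.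
    exact: fin_num_measure.
  apply: le_trans MD; apply: le_Rintegral_bm => //; first exact: kernel_bm.
    exact: bm_cst.
  by move=> v Dv; rewrite (le_trans (phi_le _)) ?ler_norm ?gram_norm_le.
pose F (z : T * T) : \bar R := (phi (gram z.1 z.2) * \1_D z.1)%:E.
have mF : measurable_fun setT F.
  apply/measurable_EFinP; apply: measurable_funM.
    apply: measurableT_comp => //; apply: measurable_sum => i.
    apply: measurable_funM; apply: measurableT_comp => //.
  apply: measurableT_comp => //. 
have F0 z : (0 <= F z)%E by rewrite lee_fin mulr_ge0.
have := measurable_fun_fubini_tonelli_G (m1 := mu) F mF F0.
move=> mG; apply: measurable_funTS.
have -> : (fun w => \int[mu]_(v in D) phi (gram v w)) = fine \o (fubini_G mu F).
  by apply/funext => w; rewrite Rintegral_mkcond patch_indic.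
exact: measurableT_comp.
Qed.

Lemma kernel_energy_max mu sigma : mu D = 1%E -> equipotential sigma ->
  (forall e, 0 < e -> exists2 Q : {poly R}, (forall k, (0 < k)%N -> Q`_k <= 0) &
    forall t, `|t| <= 1 -> `|Q.[t] - phi t| <= e) ->
  \int[mu]_(w in D) (\int[mu]_(v in D) phi (gram v w)) <=
  \int[sigma]_(w in D) (\int[sigma]_(v in D) phi (gram v w)).
Proof.
move=> muD es approx; apply/ler_addgt0Pr => e e0.
have [Q Q0 Qe] := approx (e / 2) (divr_gt0 e0 (ltr0n _ 2)).
have dist nu : nu D = 1%E ->
    `|\int[nu]_(w in D) (\int[nu]_(v in D) Q.[gram v w]) -
      \int[nu]_(w in D) (\int[nu]_(v in D) phi (gram v w))| <= e / 2.
  move=> nuD; apply: Rintegral_dist_le => //.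
  - exact: Rintegral_horner_gram_bm.
  - exact: Rintegral_kernel_bm.
  - move=> w Dw; apply: Rintegral_dist_le => //.
    + exact: horner_gram_bm.
    + exact: kernel_bm.
    + by move=> v Dv; apply: Qe; exact: gram_norm_le.
have := horner_energy_max muD es Q0.
have := dist mu muD; have := dist sigma es.1.
by rewrite !ler_distlC => /andP[? ?] /andP[? ?] ?; lra.
Qed.

Section lower_bound.
Variable c : R.
Hypothesis phi_lb : forall t, `|t| <= 1 -> c * (1 - t) <= phi t.
Variable mu : probability T R.
Hypothesis muD : mu D = 1%E.
Hypothesis mu0 : forall i, \int[mu]_(v in D) X i v = 0.

Lemma Rintegral_gram w : \int[mu]_(v in D) gram v w = 0.
Proof.
rewrite Rintegral_sum_bm// => [|i]; last by apply: bmM; [exact: coord_bm|exact: bm_cst].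
by apply: big1 => i _; rewrite RintegralZr_bm ?mu0 ?mul0r//; exact: coord_bm.
Qed.

Let aff_bm (a b : R) w : bounded_measurable D (fun v => a + b * gram v w).
Proof. by apply: bmD; [exact: bm_cst|apply: bmM; [exact: bm_cst|exact: gram_bm]]. Qed.

Lemma Rintegral_affine_gram (a b : R) w : \int[mu]_(v in D) (a + b * gram v w) = a.
Proof.
rewrite RintegralD_bm//; [|exact: bm_cst|by apply: bmM; [exact: bm_cst|exact: gram_bm]].
by rewrite RintegralZl_bm ?Rintegral_gram ?mulr0 ?addr0 ?Rintegral_cst1//; exact: gram_bm.
Qed.

Let lb_affine v w : D v -> D w -> c + - c * gram v w <= phi (gram v w).
Proof.
by move=> Dv Dw; have := phi_lb (gram_norm_le Dv Dw); rewrite mulrBr mulr1 mulNr.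
Qed.

Lemma potential_ge w : D w -> c <= \int[mu]_(v in D) phi (gram v w).
Proof.
move=> Dw; rewrite -(Rintegral_affine_gram c (- c) w).
apply: le_Rintegral_bm => [//|||v Dv]; [exact: aff_bm|exact: kernel_bm|].
exact: lb_affine.
Qed.

(** The integral of the chord c (1 - t) against mu x mu is c, since the double
integral of t is the squared norm of the barycenter. *)
Lemma kernel_energy_ge : c <= \int[mu]_(w in D) (\int[mu]_(v in D) phi (gram v w)).
Proof.
rewrite -{1}(Rintegral_cst1 mD c muD).
apply: le_Rintegral_bm => //; [exact: bm_cst|exact: Rintegral_kernel_bm|].
exact: potential_ge.
Qed.

(** Equality leaves at least one point w at which the potential attains its
lower bound c; at such a w the kernel meets the chord almost everywhere. *)
Lemma kernel_energy_eq :
  \int[mu]_(w in D) (\int[mu]_(v in D) phi (gram v w)) = c ->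
  exists2 w, D w &
    {ae mu, forall v, D v -> phi (gram v w) = c * (1 - gram v w)}.
Proof.
move=> Ec.
have [|||w Dw w0] := Rintegral_eq0_exists mD muD
   (f := fun w => \int[mu]_(v in D) phi (gram v w) + - c).
- by apply: bmD; [exact: Rintegral_kernel_bm|exact: bm_cst].
- by move=> w Dw; rewrite subr_ge0; exact: potential_ge.
- rewrite RintegralD_bm//; [|exact: Rintegral_kernel_bm|exact: bm_cst].
  by rewrite Ec Rintegral_cst1// subrr.
exists w => //.
have bphi := kernel_bm Dw.
have := @Rintegral_eq0_ae _ _ _ _ mD mu
  (fun v => phi (gram v w) + ((- c) + c * gram v w)) _ _ _.
case.
- exact: bmD.
- by move=> v Dv; have := lb_affine Dv Dw; lra.
- by rewrite RintegralD_bm// Rintegral_affine_gram.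
move=> N [mN N0 DN]; exists N; split => // v /= vP; apply: DN => /= Dv0.
by apply: vP => Dv; have := Dv0 Dv; lra.
Qed.

End lower_bound.

End kernel.

End moments.

(** * Invariant measures, two-point measures and Borel structure *)

Section invariance.
Context d (T : measurableType d) (R : realType) (D : set T).
Hypothesis mD : measurable D.

Lemma Rintegral_invariant (mu : probability T R) (g : T -> T) (f : T -> R) :
  measurable_fun setT g -> g @^-1` D = D ->
  (forall A, measurable A -> mu (g @^-1` A) = mu A) ->
  measurable_fun setT f -> bounded_measurable D f ->
  \int[mu]_(x in D) f (g x) = \int[mu]_(x in D) f x.
Proof.
move=> mg gD inv mf bf; congr fine.
have bfg : bounded_measurable D (f \o g).
  split; first by apply: measurable_funTS; exact: measurableT_comp.
  have [_ [M fM]] := bf; exists M => x Dx; apply: fM.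
  by rewrite -gD in Dx.
transitivity (\int[pushforward mu g]_(y in D) (f y)%:E)%E.
  rewrite integral_pushforward//; first by rewrite gD.
    exact/measurable_EFinP.
  rewrite gD; exact: (bm_integrable mD mu bfg).
by apply: eq_measure_integral => A mA _; exact: inv.
Qed.

End invariance.

Section two_point.
Context d (T : measurableType d) (R : realType) (a b : T).

Definition two_point : set T -> \bar R :=
  mscale (2^-1)%:nng (measure_add \d_a \d_b).

HB.instance Definition _ := Measure.on two_point.

Lemma two_pointE A : two_point A = (2^-1%:E * (\d_a A + \d_b A))%E.
Proof. by rewrite /two_point /mscale; congr (_ * _)%E; exact: measure_addE. Qed.

Let two_point_setT : two_point setT = 1%E.
Proof.
by rewrite two_pointE !diracT -EFinD -EFinM -(natrD _ 1 1) mulVf ?pnatr_eq0.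
Qed.

HB.instance Definition _ :=
  Measure_isProbability.Build _ _ _ two_point two_point_setT.

Lemma integral_two_point (D : set T) (f : T -> \bar R) : measurable D ->
  D a -> D b -> measurable_fun D f -> (forall x, D x -> (0 <= f x)%E) ->
  (\int[two_point]_(x in D) f x = 2^-1%:E * (f a + f b))%E.
Proof.
move=> mD Da Db mf f0.
rewrite ge0_integral_mscale//= ge0_integral_measure_add// !integral_dirac//.
by rewrite !diracE !mem_set// !mul1e.
Qed.

End two_point.

Section borel_euclidean.
Context (R : realType) (n : nat).
Local Notation T := (borelRn R n).

Lemma measurable_open (U : set 'rV[R]_n) : open U -> measurable (U : set T).
Proof. exact: sub_sigma_algebra. Qed.

Lemma measurable_fun_continuous (f : 'rV[R]_n -> R) :
  continuous f -> measurable_fun setT (f : T -> R).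
Proof.
move=> cf; apply: (@measurability _ _ T _ setT f _ (RGenOpens.measurableE R)).
move=> _ [_ [x [y ->]] <-]; rewrite setTI; apply: measurable_open.
by apply: open_comp => [z _|]; [exact: cf|exact: interval_open].
Qed.

Lemma measurable_map_continuous (g : 'rV[R]_n -> 'rV[R]_n) :
  continuous g -> measurable_fun setT (g : T -> T).
Proof.
move=> cg; apply: (@measurability _ _ T T setT g open) => //.
move=> _ [U oU <-]; rewrite setTI; apply: measurable_open.
by apply: open_comp => // z _; exact: cg.
Qed.

Definition coordf (i : 'I_n) : T -> R := fun v => (v : 'rV[R]_n) ord0 i.

Lemma measurable_coordf i : measurable_fun setT (coordf i).
Proof. by apply: measurable_fun_continuous => x; exact: coord_continuous. Qed.

Lemma coordf_sphere (v : T) : sphere R n v -> \sum_(i < n) coordf i v ^+ 2 = 1.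
Proof.
by move/sphere_dotp <-; apply: eq_bigr => i _; rewrite expr2.
Qed.

Lemma isometry_continuous (g : 'rV[R]_n -> 'rV[R]_n) :
  (forall x y, enorm (g x - g y) = enorm (x - y)) -> continuous g.
Proof.
move=> gE x U /nbhs_ballP[e /= e0 eU].
apply/nbhs_ballP; exists (e / n.+1%:R) => [|y]; first by rewrite /= divr_gt0.
rewrite -ball_normE /= => xy; apply: eU; rewrite -ball_normE /=.
apply: le_lt_trans (ler_norm_enorm _) _; rewrite gE.
apply: (@le_lt_trans _ _ (n%:R * `|x - y|)).
  apply: enorm_le_coord => // i; rewrite [leRHS]mx_normrE.
  exact: (le_bigmax _ (fun i => `|(x - y) i.1 i.2|) (ord0, i)).
apply: (@le_lt_trans _ _ (n.+1%:R * `|x - y|)); first by rewrite ler_wpM2r// ler_nat.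
by rewrite mulrC -ltr_pdivlMr.
Qed.

Lemma dotp_gram (v w : 'rV[R]_n) : dotp v w = gram coordf v w.
Proof. by []. Qed.

(** Polarization: |v - w|^2 = 2 - 2 <v, w> for unit vectors. *)
Lemma enorm_gram (p : R) (v w : 'rV[R]_n) : sphere R n v -> sphere R n w ->
  enorm (v - w) `^ p = (2 - 2 * gram coordf v w) `^ (p / 2).
Proof.
move=> /sphere_dotp v1 /sphere_dotp w1.
have -> : 2 - 2 * gram coordf v w = enorm (v - w) ^+ 2.
  rewrite enorm_sqr dotpDl !dotpDr !dotpNl !dotpNr v1 w1 (dotpC w v) dotp_gram; ring.
by rewrite -powR_mulrn ?enorm_ge0// -powRrM mulrC divfK.
Qed.

End borel_euclidean.

(** * The uniform measure on the sphere *)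

Section antipodal.
Context (R : realType) (n : nat).
Local Notation T := (borelRn R n).
Local Notation S := (sphere R n).

Lemma opp_preimage_sphere : -%R @^-1` S = S.
Proof. by apply: isometry_preimage_sphere; [exact: opp_isometry|exact: oppr0]. Qed.

Lemma P0_barycenter (mu : probability T R) : P0 R n mu ->
  mu S = 1%E /\ forall i, \int[mu]_(v in S) coordf i v = 0.
Proof. by move=> [muS mu0]; split => // i; rewrite /Rintegral mu0. Qed.

(** The coordinates are odd functions, so their integrals are their own
opposites. *)
Lemma P0_even (mu : probability T R) : mu S = 1%E ->
  (forall A : set T, measurable A -> mu (-%R @^-1` A) = mu A) -> P0 R n mu.
Proof.
move=> muS inv; split => // i.
have mS := @measurable_sphere R n.
have bc := coord_bm (@measurable_coordf R n) (@coordf_sphere R n) i.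
rewrite [LHS](bm_integralE mS mu bc); congr _%:E.
have mopp := measurable_map_continuous (isometry_continuous (@opp_isometry R n)).
have := Rintegral_invariant mS mopp opp_preimage_sphere inv (measurable_coordf i) bc.
have -> : \int[mu]_(x in S) coordf i (- (x : 'rV[R]_n)) = \int[mu]_(x in S) (-1 * coordf i x).
  by apply: eq_Rintegral => x _; rewrite /coordf mxE mulN1r.
by rewrite RintegralZl_bm// => h; lra.
Qed.

End antipodal.

Section uniform.
Context (R : realType) (m : nat).
Hypothesis m0 : (0 < m)%N.
Local Notation n := m.+1.
Local Notation T := (borelRn R n).
Local Notation S := (sphere R n).
Local Notation sigma := (sphere_uniform R n).

Lemma sphere_uniformE (A : set T) :
  sigma A = (hausdorff m (A `&` S) * (fine (hausdorff m S))^-1%:E)%E.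
Proof.
rewrite /sphere_uniform /= /mnormalize /= /mrestr setTI ifF//.
by rewrite (gt_eqF (hausdorff_sphere_gt0 R m0)) (lt_eqF (hausdorff_sphere_lty R m)).
Qed.

Lemma sphere_uniform_sphere : sigma S = 1%E.
Proof.
rewrite sphere_uniformE setIid.
have h0 := hausdorff_sphere_gt0 R m0; have hy := hausdorff_sphere_lty R m.
have hfin : hausdorff m S \is a fin_num by rewrite ge0_fin_numE// ltW.
by rewrite -[X in (X * _)%E](fineK hfin) -EFinM divff// gt_eqF// fine_gt0// h0.
Qed.

Lemma sphere_uniform_isometry (g : 'rV[R]_n -> 'rV[R]_n) (A : set T) :
  (forall x y, enorm (g x - g y) = enorm (x - y)) -> involutive g ->
  g @^-1` S = S -> sigma (g @^-1` A) = sigma A.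
Proof.
move=> gE gK gS; rewrite !sphere_uniformE; congr (_ * _)%E.
have img (B : set 'rV[R]_n) : g @` B = g @^-1` B.
  apply/seteqP; split => [_ [x Bx <-] /=|x Bx]; first by rewrite gK.
  by exists (g x) => //; rewrite gK.
have le B : (hausdorff m (g @^-1` B `&` S) <= hausdorff m (B `&` S))%E.
  by rewrite -{1}gS -preimage_setI -img; exact: hausdorff_isometry_le.
apply/eqP; rewrite eq_le le/=.
have := le (g @^-1` A); rewrite -comp_preimage.
by have -> : g \o g = id by apply/funext => x /=; rewrite gK.
Qed.

Lemma sphere_uniform_P0 : P0 R n sigma.
Proof.
apply: P0_even; first exact: sphere_uniform_sphere.
move=> A _; apply: (sphere_uniform_isometry (g := -%R)).
- exact: opp_isometry.
- exact: opprK.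
- exact: opp_preimage_sphere.
Qed.

(** The reflection that exchanges w and w' preserves the measure and carries
the potential at w to the potential at w'. *)
Lemma sphere_uniform_equipotential :
  equipotential (S : set T) (@coordf R n) sigma.
Proof.
split; first exact: sphere_uniform_sphere.
have mS := @measurable_sphere R n.
move=> k w w' Sw Sw'; pose g := reflection (w - w').
have gE := @reflection_isometry R n (w - w').
have g0 : g 0 = 0.
  by rewrite /g /reflection -(scale0r 0) dotpZl mul0r mulr0 mul0r !scale0r subr0.
have gS := isometry_preimage_sphere gE g0.
have gK := @reflectionK R n (w - w').
have gwE : g w = w' by apply: reflection_swap.
have mg := measurable_map_continuous (isometry_continuous gE).
have inv (A : set T) : measurable A -> sigma (g @^-1` A) = sigma A.
  by move=> _; exact: sphere_uniform_isometry.
have bX (u : T) : bounded_measurable (S : set T) (fun v => gram (@coordf R n) v u ^+ k).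
  by apply: bmX => //; apply: gram_bm => //; [exact: measurable_coordf|exact: coordf_sphere].
have mXk (u : T) : measurable_fun setT (fun v : T => gram (@coordf R n) v u ^+ k).
  apply: measurable_funX; apply: measurable_sum => i.
  by apply: measurable_funM => //; exact: measurable_coordf.
rewrite -[RHS](Rintegral_invariant mS mg gS inv (mXk w') (bX w')).
apply: eq_Rintegral => v _; congr (_ ^+ k).
have := isometry_dotp v w gE g0; rewrite -/g gwE => /esym.
exact.
Qed.

End uniform.

(** * The kernel |v - w|^p and its energy *)

Section energy_kernel.
Context (R : realType) (p : R).
Hypothesis p0 : 0 < p.
Hypothesis p2 : p < 2.

Definition riesz (t : R) : R := (2 - 2 * t) `^ (p / 2).

Lemma riesz_ge0 t : 0 <= riesz t. Proof. exact: powR_ge0. Qed.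

Lemma measurable_riesz : measurable_fun setT riesz.
Proof.
have -> : riesz = (fun x => x `^ (p / 2)) \o (fun t => 2 - 2 * t) by [].
apply: measurableT_comp; first exact: measurable_powR.
by apply: measurable_funB => //; apply: measurable_funM.
Qed.

Let half_p01 : (0 : R) < p / 2 < 1. Proof. by rewrite divr_gt0//= ltr_pdivrMr// mul1r. Qed.

Let rieszE t : `|t| <= 1 -> riesz t = 2 `^ (p / 2) * (1 - t) `^ (p / 2).
Proof.
move=> t1; have := ler_normlW t1 => tle.
by rewrite /riesz -{1}[2]mulr1 -mulrBr powRM ?subr_ge0.
Qed.

Lemma riesz_approx e : 0 < e -> exists2 Q : {poly R},
  (forall k, (0 < k)%N -> Q`_k <= 0) &
  forall t, `|t| <= 1 -> `|Q.[t] - riesz t| <= e.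
Proof.
move=> e0; have c0 : 0 < 2 `^ (p / 2) :> R by rewrite powR_gt0.
have [Q Q0 Qe] := powR_poly_approx half_p01 (divr_gt0 e0 c0).
exists (2 `^ (p / 2) *: Q) => [k k0|t t1].
  by rewrite coefZ mulr_ge0_le0 ?Q0// ltW.
rewrite hornerZ rieszE// -mulrBr normrM (gtr0_norm c0).
by rewrite -ler_pdivlMl// [leRHS]mulrC Qe.
Qed.

Let half_gap01 (t : R) : `|t| <= 1 -> (0 : R) <= (1 - t) / 2 <= 1.
Proof. by rewrite ler_norml => /andP[? ?]; apply/andP; split; lra. Qed.

(** With x = (1 - t) / 2 in [0, 1], the inequality between the kernel and its
chord becomes x^(p/2) >= x, with equality only at 0 and 1. *)
Let riesz_scaled t : `|t| <= 1 -> riesz t = 2 * 2 `^ (p - 1) * ((1 - t) / 2) `^ (p / 2).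
Proof.
move=> t1; have /andP[x0 _] := half_gap01 t1.
have -> : riesz t = (4 * ((1 - t) / 2)) `^ (p / 2).
  by rewrite /riesz; congr (_ `^ _); field.
rewrite powRM//; congr (_ * _).
rewrite mulr_powRB1//.
have -> : 4 = 2 `^ 2%:R :> R by rewrite powR_mulrn//; ring.
by rewrite -powRrM; congr (_ `^ _); field.
Qed.

Lemma riesz_le t : `|t| <= 1 -> riesz t <= 2 * 2 `^ (p - 1).
Proof.
move=> t1; have /andP[x0 x1] := half_gap01 t1; rewrite riesz_scaled //.
rewrite ler_piMr ?mulr_ge0 ?powR_ge0//.
apply: (@le_trans _ _ (1 `^ (p / 2))); last by rewrite powR1.
by apply: ge0_ler_powR; rewrite ?nnegrE// divr_ge0// ltW.
Qed.

Let rieszB t : `|t| <= 1 -> riesz t - 2 `^ (p - 1) * (1 - t) =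
  2 * 2 `^ (p - 1) * (((1 - t) / 2) `^ (p / 2) - (1 - t) / 2).
Proof. by move=> t1; rewrite riesz_scaled//; field. Qed.

Lemma riesz_chord t : `|t| <= 1 -> 2 `^ (p - 1) * (1 - t) <= riesz t.
Proof.
move=> t1; rewrite -subr_ge0 rieszB// mulr_ge0 ?mulr_ge0 ?powR_ge0// subr_ge0.
have /andP[x0 x1] := half_gap01 t1; have /andP[h0 h1] := half_p01.
have [->|xn0] := eqVneq ((1 - t) / 2) 0; first exact: powR_ge0.
by apply: ger1_powR; [rewrite lt0r xn0 x0 x1|exact: ltW].
Qed.

Lemma riesz_chord_eq t : `|t| <= 1 -> riesz t = 2 `^ (p - 1) * (1 - t) ->
  t = 1 \/ t = -1.
Proof.
move=> t1 /eqP; rewrite -subr_eq0 rieszB// mulf_eq0 mulf_eq0 pnatr_eq0 /=.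
rewrite gt_eqF ?powR_gt0//= subr_eq0 => /eqP.
have /andP[x0 x1] := half_gap01 t1; have /andP[h0 h1] := half_p01.
have [x00|xn0] := eqVneq ((1 - t) / 2) 0; first by move=> _; left; lra.
have xp : 0 < (1 - t) / 2 by rewrite lt0r xn0.
move=> /(congr1 (@ln R)); rewrite ln_powR => lnE.
right; have : (p / 2 - 1) * ln ((1 - t) / 2) = 0.
  by rewrite mulrBl mul1r lnE subrr.
move/eqP; rewrite mulf_eq0 subr_eq0 (lt_eqF h1) ln_eq0//= => /eqP; lra.
Qed.

End energy_kernel.

Section energy.
Context (R : realType) (n : nat) (p : R).
Hypothesis p0 : 0 < p.
Hypothesis p2 : p < 2.
Local Notation T := (borelRn R n).
Local Notation S := (sphere R n).
Let mS := @measurable_sphere R n.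
Let mX := @measurable_coordf R n.
Let X1 := @coordf_sphere R n.
Local Notation gr := (gram (@coordf R n)).
Implicit Types mu : probability T R.

Let mr := measurable_riesz p.
Let r0 := @riesz_ge0 R p.
Let rM := @riesz_le R p p0.

Lemma J_riesz mu :
  J p mu = (\int[mu]_(w in S) (\int[mu]_(v in S) riesz p (gr v w)))%:E.
Proof.
rewrite -bm_integralE//; last exact: (Rintegral_kernel_bm mS mX X1 mr r0 rM mu).
apply: eq_integral => w /set_mem Sw; rewrite -bm_integralE//; last first.
  exact: (kernel_bm mX X1 mr r0 rM).
by apply: eq_integral => v /set_mem Sv; rewrite enorm_gram.
Qed.

Lemma J_ge mu : P0 R n mu -> ((2 `^ (p - 1))%:E <= J p mu)%E.
Proof.
move=> /P0_barycenter[muS mu0]; rewrite J_riesz lee_fin.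
exact: (kernel_energy_ge mS mX X1 mr r0 rM (riesz_chord p0 p2) muS mu0).
Qed.

Lemma J_le mu sigma : mu S = 1%E -> equipotential (S : set T) (@coordf R n) sigma ->
  (J p mu <= J p sigma)%E.
Proof.
move=> muS es; rewrite !J_riesz lee_fin.
exact: (kernel_energy_max mS mX X1 mr r0 rM muS es (riesz_approx p0 p2)).
Qed.

End energy.

(** * Minimizers *)

Section minimizers.
Context (R : realType) (n : nat) (p : R).
Hypothesis p0 : 0 < p.
Hypothesis p2 : p < 2.
Local Notation T := (borelRn R n).
Local Notation S := (sphere R n).
Let mS := @measurable_sphere R n.
Let mX := @measurable_coordf R n.
Let X1 := @coordf_sphere R n.
Let mr := measurable_riesz p.
Let r0 := @riesz_ge0 R p.
Let rM := @riesz_le R p p0.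

Lemma Rintegral_two_point (a b : T) (f : T -> R) : S a -> S b ->
  bounded_measurable (S : set T) f -> (forall x, S x -> 0 <= f x) ->
  \int[two_point R a b]_(x in S) f x = 2^-1 * (f a + f b).
Proof.
move=> Sa Sb bf f0; have mf : measurable_fun (S : set T) (EFin \o f).
  by apply/measurable_EFinP; exact: bf.1.
by rewrite /Rintegral (integral_two_point mS Sa Sb mf)// => x Sx; rewrite lee_fin f0.
Qed.

Lemma sphere_opp (v : 'rV[R]_n) : S v -> S (- v).
Proof. by move=> Sv; rewrite -[S]opp_preimage_sphere /= opprK. Qed.

Lemma sphere_opp_neq (u : 'rV[R]_n) : S u -> - u <> u.
Proof.
move=> /sphere_dotp u1 uN; have : dotp u u = - dotp u u by rewrite -dotpNl uN.
by rewrite u1 => h; lra.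
Qed.

Lemma two_point_P0 (v : 'rV[R]_n) : S v -> P0 R n (two_point R (v : T) (- v)).
Proof.
move=> Sv; apply: P0_even => [|A mA].
  rewrite [LHS]two_pointE !diracE !mem_set//; last exact: sphere_opp.
  by rewrite -EFinD -EFinM -(natrD _ 1 1) mulVf ?pnatr_eq0.
rewrite [LHS]two_pointE [RHS]two_pointE addeC !diracE; congr (_ * (_ + _))%E.
by rewrite -[in RHS](opprK v).
Qed.

Lemma riesz1 : riesz p 1 = 0.
Proof. by rewrite /riesz mulr1 subrr powR0// gt_eqF// divr_gt0. Qed.

Lemma rieszN1 : riesz p (-1) = 2 * 2 `^ (p - 1).
Proof.
have N1 : `|-1 : R| <= 1 by rewrite normrN1.
apply/eqP; rewrite eq_le riesz_le//=.
by apply: le_trans (riesz_chord p0 p2 N1); rewrite opprK mulrC.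
Qed.

Lemma J_two_point (v : 'rV[R]_n) : S v ->
  J p (two_point R (v : T) (- v)) = (2 `^ (p - 1))%:E.
Proof.
move=> Sv; have SNv := sphere_opp Sv; rewrite J_riesz//; congr _%:E.
have pot w : S w -> dotp v w = 1 \/ dotp v w = -1 ->
    \int[two_point R (v : T) (- v)]_(u in S) riesz p (gram (@coordf R n) u w) = 2 `^ (p - 1).
  move=> Sw dvw; rewrite Rintegral_two_point//; first last.
    exact: (kernel_bm mX X1 mr r0 rM).
  rewrite -!dotp_gram dotpNl.
  by case: dvw => ->; rewrite ?opprK riesz1 rieszN1; field.
rewrite Rintegral_two_point//; first last.
- by move=> w _; apply: Rintegral_ge0 => u _; exact: r0.
- exact: (Rintegral_kernel_bm mS mX X1 mr r0 rM).
have /sphere_dotp v1 := Sv.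
by rewrite !pot//; [field|right; rewrite dotpNr v1|left].
Qed.

Lemma measurable_point (u : 'rV[R]_n) : measurable ([set u] : set T).
Proof.
rewrite -[X in measurable X]setCK; apply: measurableC; apply: measurable_open.
apply: closed_openC; apply: accessible_closed_set1.
by apply: hausdorff_accessible; exact: norm_hausdorff.
Qed.

Lemma dotp1_eq (u v : 'rV[R]_n) : S u -> S v -> dotp v u = 1 -> v = u.
Proof.
move=> /sphere_dotp u1 /sphere_dotp v1 vu; apply/eqP; rewrite -subr_eq0; apply/eqP.
apply: dotpvv_eq0; rewrite dotpDl !dotpDr !dotpNl !dotpNr u1 v1 (dotpC u) vu; ring.
Qed.

(** If mu lives on the two points u and -u, then (1 + <v, u>) / 2 is the
indicator of u almost everywhere, and its integral is 1/2 because the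
barycenter is 0. *)
Lemma ae_antipodal_half (mu : probability T R) (u : 'rV[R]_n) :
  P0 R n mu -> S u ->
  {ae mu, forall v : T, S v -> v = u \/ v = - u} ->
  mu [set u] = (2^-1)%:E.
Proof.
move=> /P0_barycenter[muS mu0] Su aeu.
have bg := @gram_bm _ T R S n _ mX X1 u.
have bh : bounded_measurable (S : set T) (fun v => 2^-1 + 2^-1 * gram (@coordf R n) v u).
  by apply: bmD => //; [exact: bm_cst|apply: bmM => //; exact: bm_cst].
rewrite -[in RHS](Rintegral_affine_gram mS mX X1 muS mu0 2^-1 2^-1 u).
rewrite -bm_integralE//.
rewrite (ae_eq_integral (fun v : T => (\1_[set u] v)%:E)) //.
- rewrite integral_indic//; last exact: measurable_point.
  by congr (mu _); apply/seteqP; split => [_ ->|x []].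
- by apply/measurable_EFinP; exact: bh.1.
- apply/measurable_EFinP; apply: measurable_indic; exact: measurable_point.
move: aeu => [N [mN N0 DN]]; exists N; split => // v /= vP; apply: DN => /= Sv0.
apply: vP => Sv; congr _%:E; rewrite -dotp_gram indicE.
have /sphere_dotp u1 := Su.
have [->|->] := Sv0 Sv; first by rewrite mem_set//= u1 mulr1n; field.
rewrite memNset ?dotpNl ?u1 ?mulr0n /=; first by ring.
exact: sphere_opp_neq.
Qed.

(** The two-point measure is a lower bound for mu on A and on its complement,
and both measures have total mass 1. *)
Lemma two_point_of_half (mu : probability T R) (u : 'rV[R]_n) (A : set T) :
  S u -> mu [set u] = (2^-1)%:E -> mu [set - u] = (2^-1)%:E -> measurable A ->
  mu A = (2^-1%:E * (\d_(u : T) A + \d_((- u)%R : T) A))%E.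
Proof.
move=> Su hu hNu mA.
have mu1 := measurable_point u; have mu2 := measurable_point (- u).
have hU : mu ([set u] `|` [set - u]) = ((2^-1)%:E + (2^-1)%:E)%E.
  transitivity (mu [set u] + mu [set (- u)%R])%E; last by rewrite hu hNu.
  apply: measureU => //.
  by apply/seteqP; split => // x [-> /esym /(sphere_opp_neq Su)].
have lb B : measurable B ->
    (2^-1%:E * (\d_(u : T) B + \d_((- u)%R : T) B) <= mu B)%E.
  move=> mB; rewrite !diracE.
  have [uB|uB] := boolP (u \in B); have [NuB|NuB] := boolP (- u \in B) => /=.
  - apply: (@le_trans _ _ (mu ([set u] `|` [set - u]))).
      by rewrite hU -!EFinD -EFinM mulrDr !mulr1.
    apply: le_measure; rewrite ?inE//; first exact: measurableU.
    by move=> x [->|->]; exact: set_mem.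
  - rewrite adde0 mule1 -hu; apply: le_measure; rewrite ?inE// => x ->; exact: set_mem.
  - rewrite add0e mule1 -hNu; apply: le_measure; rewrite ?inE// => x ->; exact: set_mem.
  - by rewrite adde0 mule0.
have Afin : mu A = (fine (mu A))%:E by rewrite fineK//; exact: fin_num_measure.
have muC : mu (~` A) = (1 - fine (mu A))%:E.
  by rewrite EFinB -Afin; exact: (probability_setC mu).
have := lb _ mA; have := lb _ (measurableC mA).
rewrite muC !diracE !in_setC Afin -!EFinD -!EFinM !lee_fin => h1 h2; congr _%:E.
move: h1 h2; clear Afin muC hU hu hNu lb; move: (fine (mu A)) => x.
by case: (u \in A); case: (- u \in A) => /= h1 h2; lra.
Qed.

Lemma J_min_two_point (mu : probability T R) : P0 R n mu ->
  J p mu = (2 `^ (p - 1))%:E ->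
  exists2 v : 'rV[R]_n, S v & forall A : set T, measurable A ->
    mu A = (2^-1%:E * (\d_(v : T) A + \d_((- v)%R : T) A))%E.
Proof.
move=> Pmu; have [muS mu0] := P0_barycenter Pmu.
rewrite J_riesz// => -[Jc].
have [w Sw aew] := kernel_energy_eq mS mX X1 mr r0 rM (riesz_chord p0 p2) muS mu0 Jc.
have aepm : {ae mu, forall v : T, S v -> v = w \/ v = - w}.
  move: aew => [N [mN N0 DN]]; exists N; split => // v /= vP; apply: DN => /= Sv0.
  apply: vP => Sv.
  have [g1|g1] := riesz_chord_eq p0 p2 (gram_norm_le X1 Sv Sw) (Sv0 Sv).
    by left; apply: dotp1_eq.
  right; apply: dotp1_eq => //; first exact: sphere_opp.
  by rewrite dotpNr dotp_gram g1 opprK.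
exists w => // A mA; apply: two_point_of_half => //.
  exact: ae_antipodal_half.
apply: ae_antipodal_half => //; first exact: sphere_opp.
move: aepm => [N [mN N0 DN]]; exists N; split => // v /= vP; apply: DN => /= Sv0.
by apply: vP => /Sv0; rewrite opprK => -[]; [right|left].
Qed.

End minimizers.

Lemma sphere_nonempty (R : realType) (n : nat) : exists v, sphere R n.+1 v.
Proof.
exists (delta_mx 0 0); apply/sphere_dotp; rewrite /dotp (bigD1 ord0)//= !mxE !eqxx mulr1.
by rewrite big1 ?addr0// => i i0; rewrite !mxE (negbTE i0) andbF mulr0.
Qed.

Theorem proposition4p4 (R : realType) (n : nat) (p : R)
    (hn : (2 <= n)%N) (hp0 : 0 < p) (hp2 : p < 2) :
  [/\ c_inf n p = (2 `^ (p - 1))%:E,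
      exists mu : probability (borelRn R n) R,
        P0 R n mu /\ J p mu = c_inf n p,
      forall mu : probability (borelRn R n) R,
        P0 R n mu -> J p mu = c_inf n p ->
        exists2 v : 'rV[R]_n, sphere R n v &
          forall A : set (borelRn R n), measurable A ->
            mu A = (2^-1%:E * (\d_(v : borelRn R n) A + \d_((- v)%R : borelRn R n) A))%E
    & C_sup n p = J p (sphere_uniform R n)].
Proof.
case: n hn => // m m0.
have [v Sv] := sphere_nonempty R m.
have cE : c_inf m.+1 p = (2 `^ (p - 1))%:E.
  apply/eqP; rewrite eq_le; apply/andP; split.
    apply: ereal_inf_lbound.
    by exists (two_point R (v : borelRn R m.+1) (- v)); [exact: two_point_P0|exact: J_two_point].
  by apply: le_ereal_inf_tmp => _ [mu Pmu <-]; exact: J_ge.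
split => //.
- exists (two_point R (v : borelRn R m.+1) (- v)).
  by rewrite cE; split; [exact: two_point_P0|exact: J_two_point].
- by move=> mu Pmu; rewrite cE; exact: J_min_two_point.
apply/eqP; rewrite eq_le; apply/andP; split.
  apply: ge_ereal_sup => _ [mu Pmu <-].
  by apply: J_le => //; [exact: Pmu.1|exact: sphere_uniform_equipotential].
by apply: ereal_sup_ubound; exists (sphere_uniform R m.+1) => //; exact: sphere_uniform_P0.
Qed.
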